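(* Let $N\ge 3$, let $D\subset\mathbb{R}^N$ be a bounded Lipschitz domain, and let $\varphi:\mathbb{R}_+\to\mathbb{R}_+$ be a continuous nondecreasing function with $\varphi(0)=0$. Assume that $$\limsup_{t\to 0}\frac{\varphi(t)}{t}<\infty.$$ Then $H_D^\varphi f\approx H_Df$ for every nonnegative continuous function $f$ on $\partial D$.
   Context: $\mathbb{R}_+=[0,\infty[$. For $f\in\mathcal{C}(\partial D)$, $H_Df$ denotes the unique function in $\mathcal{C}(\overline{D})$ that is harmonic in $D$ and equals $f$ on $\partial D$. For nonnegative $f\in\mathcal{C}(\partial D)$, $H_D^\varphi f$ denotes the unique nonnegative function $u\in\mathcal{C}(\overline{D})$ satisfying $\Delta u=2\varphi(u)$ in $D$ (in the sense of distributions) and $u=f$ on $\partial D$; existence and uniqueness are known for $\varphi$ continuous nondecreasing with $\varphi(0)=0$. For two nonnegative functions $u,v$ on $D$, $u\approx v$ ($u$ and $v$ are proportional) means that there exists a constant $c>0$ such that $\frac1c v(x)\le u(x)\le c\,v(x)$ for every $x\in D$. *)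

(* Defs.v *)
From HB Require Import structures.
From mathcomp Require Import all_boot all_order all_algebra.
From mathcomp Require Import all_classical all_reals all_analysis.

Set Implicit Arguments.
Unset Strict Implicit.
Unset Printing Implicit Defensive.
Import Order.TTheory GRing.Theory Num.Theory.
Import numFieldNormedType.Exports.
Local Open Scope classical_set_scope.
Local Open Scope ring_scope.

Section lebesgue_step.
Local Open Scope ereal_scope.
Context {R : realType} (n : nat).
Local Notation tupleR m := (m.-tuple (measurableTypeR R)).

Definition tuple_cons (p : measurableTypeR R * tupleR n) : tupleR n.+1 :=
  [tuple of p.1 :: p.2].

Lemma measurable_tuple_cons : measurable_fun [set: _] tuple_cons.
Proof. exact: (measurable_cons measurable_fst measurable_snd). Qed.

Variable mu : {sigma_finite_measure set (tupleR n) -> \bar R}.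

Definition lebesgue_step : set (tupleR n.+1) -> \bar R :=
  pushforward (@lebesgue_measure R \x mu) tuple_cons.

Let measurable_preimage (A : set (tupleR n.+1)) :
  measurable A -> measurable (tuple_cons @^-1` A).
Proof.
by move=> mA; rewrite -[X in measurable X]setTI; exact: measurable_tuple_cons.
Qed.

Let lebesgue_step0 : lebesgue_step set0 = 0.
Proof. by rewrite /lebesgue_step /pushforward preimage_set0 measure0. Qed.

Let lebesgue_step_ge0 A : 0 <= lebesgue_step A.
Proof. by rewrite /lebesgue_step /pushforward; exact: measure_ge0. Qed.

Let lebesgue_step_sigma_additive : semi_sigma_additive lebesgue_step.
Proof.
move=> F mF tF mUF; rewrite /lebesgue_step /pushforward preimage_bigcup.
apply: measure_semi_sigma_additive.
- by move=> k; exact: measurable_preimage.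
- apply/trivIsetP => /= i j _ _ ij; rewrite -preimage_setI.
  by move/trivIsetP : tF => /(_ _ _ _ _ ij) ->//; rewrite preimage_set0.
- by rewrite -preimage_bigcup; exact: measurable_preimage.
Qed.

HB.instance Definition _ := isMeasure.Build _ _ _ lebesgue_step
  lebesgue_step0 lebesgue_step_ge0 lebesgue_step_sigma_additive.

Let lebesgue_step_sigma_finite : sigma_finite [set: tupleR n.+1] lebesgue_step.
Proof.
pose g (t : tupleR n.+1) : measurableTypeR R * tupleR n :=
  (thead t, [tuple of behead t]).
have gK : cancel tuple_cons g.
  move=> [x t]; rewrite /g /tuple_cons /= theadE; congr pair.
  exact/val_inj.
have Kg : cancel g tuple_cons.
  by move=> t; rewrite /tuple_cons /g /= [RHS]tuple_eta; exact/val_inj.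
have mg : measurable_fun [set: tupleR n.+1] g.
  apply/measurable_fun_pairP; split; first exact: measurable_tnth.
  exact: measurable_behead.
have /sigma_finiteP[F [TF ndF Foo]] := sigma_finiteT (@lebesgue_measure R).
have /sigma_finiteP[G [TG ndG Goo]] := sigma_finiteT mu.
exists (fun k => g @^-1` (F k `*` G k)) => [|k].
  rewrite predeqE => t; split => // _.
  have [i _ Fi] : (\bigcup_i F i) (g t).1 by rewrite -TF.
  have [j _ Gj] : (\bigcup_i G i) (g t).2 by rewrite -TG.
  exists (maxn i j) => //; split.
  - by move: Fi; exact/subsetPset/ndF/leq_maxl.
  - by move: Gj; exact/subsetPset/ndG/leq_maxr.
have [mF Fk] := Foo k; have [mG Gk] := Goo k; split.
  by rewrite -[X in measurable X]setTI; apply: mg => //; exact: measurableX.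
rewrite /lebesgue_step /pushforward -comp_preimage.
rewrite (_ : g \o tuple_cons = id) ?preimage_id; last exact/funext.
by rewrite product_measure1E// lte_mul_pinfty// ge0_fin_numE.
Qed.

HB.instance Definition _ := Measure_isSigmaFinite.Build _ _ _ lebesgue_step
  lebesgue_step_sigma_finite.

End lebesgue_step.

Section lebesgue_measure0.
Context {R : realType}.

Definition lebesgue_measure0 : set (0.-tuple (measurableTypeR R)) -> \bar R :=
  dirac [tuple].

HB.instance Definition _ := Measure.on lebesgue_measure0.

Let lebesgue_measure0_sigma_finite : sigma_finite [set: _] lebesgue_measure0.
Proof.
by apply: fin_num_fun_sigma_finite; [rewrite measure0|exact: fin_num_measure].
Qed.

HB.instance Definition _ := Measure_isSigmaFinite.Build _ _ _ lebesgue_measure0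
  lebesgue_measure0_sigma_finite.

End lebesgue_measure0.

(* N-dimensional Lebesgue measure, as the N-fold product of the measure on the
   line; the library has products of two measures only. *)
Fixpoint lebesgue_measure_tuple (R : realType) (n : nat) :
    {sigma_finite_measure set (n.-tuple (measurableTypeR R)) -> \bar R} :=
  match n with
  | 0 => lebesgue_measure0
  | m.+1 => lebesgue_step (lebesgue_measure_tuple R m)
  end.

(* Euclidean space R^N is 'rV[R]_N.  Its library norm is the sup norm; below
   it only enters through topology, boundedness and Lipschitz continuity, where
   it is interchangeable with the Euclidean norm. *)

Section euclidean.
Context {R : realType} {N : nat}.
Implicit Types (D : set 'rV[R]_N) (f h u psi : 'rV[R]_N -> R) (phi : R -> R).

Definition integral_rV D f : R :=
  \int[lebesgue_measure_tuple R N]_(t in [set t | D (\row_i tnth t i)])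
    f (\row_i tnth t i).

Definition boundary D : set 'rV[R]_N := closure D `&` closure (~` D).

(* Near every boundary point, in suitable orthonormal coordinates
   y = x *m A, D is the strict epigraph {y_i > g(y')} of a Lipschitz function g
   of the remaining N - 1 coordinates y' = col' i y. *)
Definition lipschitz_boundary D : Prop :=
  forall z, boundary D z ->
    exists (A : 'M[R]_N) (i : 'I_N) (g : 'rV[R]_N.-1 -> R),
      [/\ A *m A^T = 1%:M, lipschitz g &
          \forall x \near z, D x <-> g (col' i (x *m A)) < (x *m A) 0 i].

Definition bounded_lipschitz_domain D : Prop :=
  [/\ open D, connected D, D !=set0, bounded_set D & lipschitz_boundary D].

Definition partial (i : 'I_N) f : 'rV[R]_N -> R := 'D_(delta_mx 0 i) f.

(* f is of class C^k on the open set D. *)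
Fixpoint Ck (k : nat) D f : Prop :=
  match k with
  | 0 => forall x, D x -> {for x, continuous f}
  | k'.+1 => (forall x, D x -> {for x, continuous f}) /\
      forall i, (forall x, D x -> derivable f x (delta_mx 0 i)) /\
                Ck k' D (partial i f)
  end.

Definition laplacian f (x : 'rV[R]_N) : R := \sum_i partial i (partial i f) x.

Definition harmonic_in D h : Prop :=
  Ck 2 D h /\ forall x, D x -> laplacian h x = 0.

Definition test_function D psi : Prop :=
  [/\ forall k, Ck k setT psi,
      compact (closure [set x | psi x != 0]) &
      closure [set x | psi x != 0] `<=` D].

(* Delta u = v on D in the sense of distributions, for u and v continuous
   on D. *)
Definition distr_laplacian_eq D u (v : 'rV[R]_N -> R) : Prop :=
  forall psi, test_function D psi ->
    integral_rV D (fun x => u x * laplacian psi x) =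
    integral_rV D (fun x => v x * psi x).

(* h represents H_D f; only the values of h on the closure of D and of f on
   the boundary of D matter. *)
Definition is_H D f h : Prop :=
  [/\ {within closure D, continuous h}, harmonic_in D h &
      forall x, boundary D x -> h x = f x].

(* u represents H_D^phi f, with the same convention. *)
Definition is_Hphi D phi f u : Prop :=
  [/\ {within closure D, continuous u},
      forall x, closure D x -> 0 <= u x,
      distr_laplacian_eq D u (fun x => 2 * phi (u x)) &
      forall x, boundary D x -> u x = f x].

Definition proportional D u (v : 'rV[R]_N -> R) : Prop :=
  exists2 c : R, 0 < c & forall x, D x -> c^-1 * v x <= u x <= c * v x.

End euclidean.

(* Main.v *)
Require Import Defs.
From mathcomp Require Import all_boot all_order all_algebra.
From mathcomp Require Import all_classical all_reals all_analysis.
From mathcomp Require Import measurable_realfun.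
From mathcomp Require Import ring lra.
Import Order.TTheory GRing.Theory Num.Theory.
Import numFieldNormedType.Exports.
Local Open Scope classical_set_scope.
Local Open Scope ring_scope.
Set Implicit Arguments.
Unset Strict Implicit.
Unset Printing Implicit Defensive.

(** Write [h] for the harmonic and [u] for the semilinear extension of [f]. As
    [Delta u >= 0], the maximum principle gives [u <= h]. By compactness [u] is bounded,
    and on a bounded range the limsup hypothesis and monotonicity give [phi t <= C t];
    hence [Delta u <= K u] with [K = 2 C], and the matter is to bound such a [u] from
    below by a multiple of [h], which has the same boundary values.

    The function [u] is only continuous, with a Laplacian in the sense of distributions.
    This is turned once and for all into a pointwise inequality: a function touching [u]
    from below at [x0] has at [x0] a Laplacian at most [2 phi (u x0)] ([visc_of_distr],
    by convolution with a product of one-dimensional bumps). All comparisons are then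
    made at an extremum of an explicit function built from [u], [h], [|x|^2] and
    Gaussians.

    For the lower bound, take [q] large and the levels [lam i = q^-(i+1)]. Suppose that
    [c h <= u] where [h >= lam i]. The function [c h - u] is then positive only in the
    layer [h < lam i], and where it is positive its Laplacian is at least
    [- K c (lam i)]. That layer is thin: each of its points is close to a ball outside
    [D], at a distance comparable to the radius, and the radius is at most of order
    [rho^i] for some [rho < 1] ([boundary_layer]). A Gaussian centred in that ball shows
    that [c h - u] is at most of order [c (lam i) rho^(2 i)] ([thin_layer]), and
    [lam i <= q h] where [h >= lam (i+1)], so that on this larger set
    [c (1 - B rho^(2 i)) h <= u]. The losses are summable, so the constants stay away
    from 0, and the levels exhaust [D] because [h > 0] there, unless [h] vanishes and
    [u] with it ([lower_comparison]).

    The layers are thin because near a boundary point [D] lies above a Lipschitz graph.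
    A point at height [t] is the centre of a ball in [D] of radius proportional to [t],
    so a lower bound for [h] can be carried down a vertical column: each step divides
    the height by a constant larger than 1 and multiplies the bound by a constant
    [theta > 0] ([ball_growth], [column_growth]). Thus [h] is at least a power of the
    height, and the points where [h] is small are at small height. The point below the
    graph symmetric to such a point is the centre of a ball outside [D]. Compactness of
    the closure makes the constants uniform. *)

(** * A smooth bump function *)

Section flat_functions.
Context {R : realType}.
Implicit Types (P : {poly R}) (t w : R).

Lemma expR_ge_pow (n : nat) w : 0 <= w -> (w / n.+1%:R) ^+ n.+1 <= expR w.
Proof.
move=> w0; rewrite -[in leRHS](@divfK _ n.+1%:R _ w)//.
rewrite expRM_natr.
rewrite lerXn2r ?nnegrE ?divr_ge0 ?expR_ge0//.
by rewrite (le_trans _ (expR_ge1Dx _))// lerDr.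
Qed.

(** The classical functions that are flat at 0. With a polynomial factor in [1/t] the
    family is stable under differentiation, so that smoothness is a statement about
    first derivatives only. *)
Definition flat P t : R := if 0 < t then P.[t^-1] * expR (- t^-1) else 0.

Lemma horner_bound P : exists C : R, 0 <= C /\ forall w, 1 <= w -> `|P.[w]| <=
  C * w ^+ size P.
Proof.
exists (\sum_(i < size P) `|P`_i|); split; first exact: sumr_ge0.
move=> w w1; rewrite horner_coef (le_trans (ler_norm_sum _ _ _))// mulr_suml.
apply: ler_sum => i _; rewrite normrM ler_wpM2l// ger0_norm; last first.
  by rewrite exprn_ge0// (le_trans _ w1).
by rewrite ler_weXn2l// ltnW.
Qed.

(** Because [exp (-1/t)] beats the power [size P + 2] of [1/t]. A quadratic bound is
    what makes the difference quotients at 0 tend to 0. *)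
Lemma flat_bound P : exists C : R, 0 <= C /\ forall t, `|t| <= 1 -> `|flat P t| <=
  C * `|t| ^+ 2.
Proof.
have [C [C0 HC]] := horner_bound P.
pose n := (size P).+1.
exists (C * n.+1%:R ^+ n.+1); split; first by rewrite mulr_ge0// exprn_ge0.
move=> t t1; rewrite /flat; case: ifPn => t0; last first.
  by rewrite normr0 mulr_ge0 ?exprn_ge0// mulr_ge0// exprn_ge0.
rewrite normrM (ger0_norm (expR_ge0 _)) expRN.
have tV : 1 <= t^-1 by rewrite invr_ge1// ?unitfE ?gt_eqF// (le_trans (ler_norm _) t1).
have H := expR_ge_pow n (ltW (lt_le_trans ltr01 tV)).
rewrite ler_pdivrMr ?expR_gt0//.
apply: (le_trans (HC _ tV)).
rewrite -2!(mulrA C) ler_wpM2l//.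
have -> : t^-1 ^+ size P = n.+1%:R ^+ n.+1 * (`|t|^+2 * (t^-1 / n.+1%:R)^+n.+1).
  rewrite (gtr0_norm t0) expr_div_n [in RHS]mulrCA [n.+1%:R ^+ _ * _]mulrC divfK ?expf_neq0//.
  by rewrite -[n.+1]/(2 + size P)%N exprD mulrA -exprMn divff ?expr1n ?mul1r// gt_eqF.
by rewrite -[leRHS]mulrA ler_wpM2l ?exprn_ge0// ler_wpM2l// exprn_ge0.
Qed.

Lemma is_derive_flat P t : is_derive t 1 (flat P) (flat ('X^2 * (P - P^`())) t).
Proof.
have [t0|t0|->] := ltgtP t 0.
- have -> : flat ('X^2 * (P - P^`())) t = 0 by rewrite /flat ltNge (ltW t0).
  apply: (@near_eq_is_derive _ _ _ (cst 0)).
  near=> s; rewrite /flat ifF//; apply/negbTE; rewrite -leNgt ltW//; near: s.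
  exact: lt_nbhsl.
- apply: (@near_eq_is_derive _ _ _ (fun s : R => P.[s^-1] * expR (- s^-1) : R)).
    near=> s; rewrite /flat ifT//; near: s; exact: lt_nbhsr.
  have t0' : t != 0 by rewrite gt_eqF.
  have dV : is_derive t 1 (fun s : R => s^-1) (- t^-2).
    have := @is_deriveV _ (@id R) t 1 1 t0' (is_derive_id _ _).
    by rewrite /= scaler1.
  have dP : is_derive t 1 (fun s : R => P.[s^-1]) (P^`().[t^-1] * (- t^-2)).
    have : is_derive (t^-1) 1 (horner P) (P^`().[t^-1]).
      apply: DeriveDef; first exact: derivable_horner.
      by rewrite -derive1E -derivE.
    move=> H. have := @is_derive1_comp R (horner P) (fun s => s^-1) t _ _ H dV.
    by rewrite /comp mulrC.
  rewrite /flat ifT//.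
  apply: is_derive_eq.
  rewrite !hornerE /= /GRing.scale /= -exprVn; ring.
- have -> : flat ('X^2 * (P - P^`())) 0 = 0 by rewrite /flat ltxx.
  have [C [C0 HC]] := flat_bound P.
  have L : h^-1 *: ((flat P \o shift 0) (h *: (1:R)) - flat P 0) @[h --> 0^'] --> (0 : R).
    apply/cvgr0Pnorm_le => e e0.
    near=> h.
    have h0 : h != 0 by near: h; exact: nbhs_dnbhs_neq.
    have [h1 h2] : `|h| <= 1 /\ `|h| <= e / (C + 1).
      split; near: h; apply: dnbhs0_le => //; rewrite divr_gt0//; lra.
    rewrite /= addr0 [h *: 1]mulr1 {2}/flat ltxx subr0 normrM normfV.
    rewrite mulrC ler_pdivrMr ?normr_gt0//.
    apply: (le_trans (HC _ h1)); rewrite expr2 mulrA ler_wpM2r//.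
    apply: (@le_trans _ _ (C * (e / (C+1)))); first by rewrite ler_wpM2l.
    rewrite mulrA ler_pdivrMr; last lra. nra.
  apply: DeriveDef; first by apply/cvg_ex; exists 0.
  by apply/cvg_lim.
Unshelve. all: by end_near. Qed.

Fixpoint smooth_upto (k : nat) (f : R -> R) : Prop :=
  if k is k'.+1 then (forall t, derivable f t 1) /\ smooth_upto k' (derive1 f) else True.

Lemma smooth_uptoW k f : smooth_upto k.+1 f -> smooth_upto k f.
Proof. by elim: k f => // k IH f [d /IH]. Qed.

Lemma smooth_uptoD k f g : smooth_upto k f -> smooth_upto k g -> smooth_upto k (f \+ g).
Proof.
elim: k f g => // k IH f g [df sf] [dg sg]; split=> [t|]; first exact: derivableD.
have -> : derive1 (f \+ g) = derive1 f \+ derive1 g; last exact: IH.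
by apply/funext => t; rewrite derive1E [LHS](deriveD (df t) (dg t)) -!derive1E.
Qed.

Lemma smooth_uptoM k f g : smooth_upto k f -> smooth_upto k g -> smooth_upto k (f \* g).
Proof.
elim: k f g => // k IH f g sf sg; have [df sf'] := sf; have [dg sg'] := sg.
split=> [t|]; first exact: derivableM.
have -> : derive1 (f \* g) = (f \* derive1 g) \+ (g \* derive1 f).
  by apply/funext => t; rewrite derive1E [LHS](deriveM (df t) (dg t)) -!derive1E.
by apply: smooth_uptoD; apply: IH => //; exact: smooth_uptoW.
Qed.

Lemma smooth_upto_flat k P (a b : R) : smooth_upto k (fun t => flat P (a * t + b)).
Proof.
elim: k P => // k IH P.
have H t : is_derive t 1 (fun t => flat P (a * t + b))
  (a * flat ('X^2 * (P - P^`())) (a * t + b)).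
  have d1 : is_derive t 1 (fun t : R => a * t + b) a.
    by apply: is_derive_eq; rewrite /GRing.scale/=; ring.
  have := @is_derive1_comp R (flat P) (fun t => a*t + b) t _ _ (is_derive_flat P _) d1.
  by rewrite mulrC.
split=> [t|]; first by have [] := H t.
have -> : derive1 (fun t => flat P (a * t + b)) =
  (fun t => flat (a%:P * ('X^2 * (P - P^`()))) (a * t + b)).
  apply/funext => t; rewrite derive1E (@derive_val _ _ _ _ _ _ _ (H t)) /flat.
  by case: ifP; rewrite ?mulr0// [in RHS]hornerM hornerC mulrA.
exact: IH.
Qed.

Lemma smooth_upto_derive1n k j f : smooth_upto (k + j) f -> smooth_upto j (derive1n k f).
Proof. by elim: k f => //= k IH f [_ /IH]; rewrite /derive1n -iterSr. Qed.

(** The function is [exp (-1/(1+t)) exp (-1/(1-t))] on the interval [-1, 1]. It comes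
    with all its derivatives [b k], because the partial derivatives of a product of such
    functions of distinct coordinates are again products of members of the sequence. *)
Lemma bump_exists : exists b : nat -> R -> R,
  [/\ forall k t, is_derive t 1 (b k) (b k.+1 t),
      forall k t, 1 <= `|t| -> b k t = 0,
      forall t, 0 <= b 0%N t & 0 < b 0%N 0].
Proof.
pose f := (fun t : R => flat 1 (1 * t + 1)) \* (fun t => flat 1 (-1 * t + 1)).
have fs k : smooth_upto k f by apply: smooth_uptoM; exact: smooth_upto_flat.
have dk k t : derivable (derive1n k f) t 1.
  have := fs (k + 1)%N => /smooth_upto_derive1n; by case.
have hd k t : is_derive t 1 (derive1n k f) (derive1n k.+1 f t).
  by apply: DeriveDef; [exact: dk|rewrite derive1nS derive1E].
have f0 k t : 1 < `|t| -> derive1n k f t = 0.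
  elim: k t => [|k IH] t t1.
    rewrite derive1n0 /f /flat /=; case: ifPn => a; last by rewrite mul0r.
    case: ifPn => b; last by rewrite mulr0.
    exfalso; move: t1; rewrite ltNge ler_norml; lra.
  rewrite derive1nS derive1E.
  rewrite (@near_eq_derive _ _ _ _ (cst 0)); first by rewrite derive_cst.
  near=> s; apply: IH; near: s.
  apply: (@cvgr_norm_gt _ _ _ (nbhs t) _ id t) => //.
exists (fun k => derive1n k f); split=> //.
- move=> k t; rewrite le_eqVlt => /orP[/eqP t1|/f0//].
  (* [b k] vanishes beyond [|t| = 1], hence also there, by continuity. *)
  have ct : {for t, continuous (derive1n k f)}.
    by apply/differentiable_continuous/derivable1_diffP.
  apply/eqP; rewrite -normr_le0; apply/ler_addgt0Pl => e e0; rewrite addr0.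
  have /cvgrPdist_le/(_ e e0) := ct.
  move/nbhs_ballP => [d /= d0 Hd].
  have tn : t != 0 by rewrite -normr_gt0 -t1.
  suff [H1 H2] : ball t d (t + t * (d/2)) /\ 1 < `|t + t * (d/2)|.
    by have := Hd _ H1; rewrite /= (f0 _ _ H2) subr0.
  split.
  + rewrite /ball/= opprD addrA subrr add0r normrN normrM -t1 mul1r gtr0_norm; lra.
  + rewrite -{1}[t]mulr1 -mulrDr normrM -t1 mul1r gtr0_norm; lra.
- move=> t; rewrite derive1n0 /f /=; apply: mulr_ge0; rewrite /flat; case: ifP => // _;
    by rewrite hornerC mul1r expR_ge0.
- rewrite derive1n0 /f /= !mulr0 !add0r /flat ltr01 hornerC mul1r.
  by rewrite mulr_gt0// expR_gt0.
Unshelve. all: by end_near. Qed.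

End flat_functions.

(** * Lebesgue measure on tuples and the topology of row vectors *)

Section rowvec.
Context {R : realType} {N : nat}.
Implicit Types (x y : 'rV[R]_N) (r : R).

Lemma coord_le_norm x j : `|x 0 j| <= `|x|.
Proof.
rewrite -[leRHS]/(mx_norm x) mx_normrE.
exact: (@le_bigmax _ _ _ 0 (fun ij : 'I_1 * 'I_N => `|x ij.1 ij.2|) (0, j)).
Qed.

Lemma norm_rV_le x r : 0 <= r -> (forall j, `|x 0 j| <= r) -> `|x| <= r.
Proof.
move=> r0 H; rewrite -[leLHS]/(mx_norm x) mx_normrE; apply/bigmax_leP; split=> // -[i j] _ /=.
by rewrite ord1.
Qed.

Lemma norm_rV_lt x r : 0 < r -> (forall j, `|x 0 j| < r) -> `|x| < r.
Proof.
move=> r0 H; rewrite -[ltLHS]/(mx_norm x) mx_normrE; apply/bigmax_ltP; split=> // -[i j] _ /=.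
by rewrite ord1.
Qed.
End rowvec.

Section tuple_measure.
Context {R : realType}.
Local Notation mR := (measurableTypeR R).
Local Notation mu N := (lebesgue_measure_tuple R N).
Implicit Types (N : nat).

Definition row_of N (t : N.-tuple mR) : 'rV[R]_N := \row_i tnth t i.

Lemma measurable_coord_box N (q : 'I_N -> R) (r : R) :
  measurable [set t : N.-tuple mR | forall j, `|tnth t j - q j| < r].
Proof.
rewrite (_ : mkset _ = \bigcap_(j in [set: 'I_N])
  ((fun t : N.-tuple mR => tnth t j) @^-1` `]q j - r, q j + r[%classic)).
  apply: fin_bigcap_measurable; first exact: finite_finset.
  move=> j _; rewrite -[X in measurable X]setTI.
  by apply: measurable_tnth => //; exact: measurable_itv.
apply/seteqP; split=> t /= H j.
  by move=> _; have := H j; rewrite /= in_itv/= ltr_distlC; lra.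
by have := H j Logic.I; rewrite /= in_itv/= ltr_distlC; lra.
Qed.

(** The sigma-algebra of tuples is generated by the coordinates and knows nothing of the
    topology; the link is that an open set is the union of the countably many rational
    boxes inside it. *)
Lemma measurable_open_row N (O : set 'rV[R]_N) : open O ->
  measurable [set t : N.-tuple mR | O (row_of t)].
Proof.
move=> oO.
pose box (p : {ffun 'I_N -> rat} * nat) :=
  [set t : N.-tuple mR | forall j, `|tnth t j - ratr (p.1 j)| < p.2.+1%:R^-1].
pose F n := if @unpickle ({ffun 'I_N -> rat} * nat)%type n is Some p then
   (if `[< box p `<=` [set t | O (row_of t)] >] then box p else set0) else set0.
rewrite (_ : mkset _ = \bigcup_n F n).
  apply: bigcup_measurable => n _; rewrite /F; case: unpickle => [p|//].
  by case: ifP => // _; exact: measurable_coord_box.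
apply/seteqP; split=> t /=; last first.
  move=> [n _]; rewrite /F; case: unpickle => [p|//].
  by case: ifPn => [/asboolP H|//]; exact: H.
move=> Ot.
have /nbhs_ballP[e /= e0 He] : nbhs (row_of t) O by exact: open_nbhs_nbhs.
(* A box of half-side [1/(n+1)] that contains [row_of t] lies in the ball of radius
   [e]. *)
pose n := Num.Def.truncn (2 / e).
have nE : 2 * n.+1%:R^-1 < e.
  rewrite ltr_pdivrMr//; rewrite mulrC -ltr_pdivrMr//.
  by rewrite /n truncnS_gt.
have n0 : 0 < n.+1%:R^-1 :> R by rewrite invr_gt0.
have Hq j : {q : rat | `|tnth t j - ratr q| < n.+1%:R^-1}.
  apply: cid.
  have lt2 : tnth t j - n.+1%:R^-1 < tnth t j + n.+1%:R^-1 by rewrite ltrBlDr -addrA ltrDl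
    addr_gt0.
  have [q] := rat_in_itvoo lt2.
  by rewrite in_itv/= => H; exists q; rewrite ltr_distlC.
pose p := ([ffun j => sval (Hq j)] : {ffun 'I_N -> rat}, n).
exists (pickle p) => //; rewrite /F pickleK ifT.
  by move=> j; rewrite /p /= ffunE; exact: (svalP (Hq j)).
apply/asboolP => s Hs; apply: He.
rewrite -ball_normE /=; apply: norm_rV_lt => // j; rewrite !mxE.
have := Hs j; rewrite /p/= ffunE => H1; have H2 := svalP (Hq j).
rewrite -(subrKA (ratr (sval (Hq j)))).
apply: (le_lt_trans (ler_normD _ _)).
rewrite [X in _ + X]distrC; apply: lt_trans nE. rewrite mulr2n mulrDl mul1r ltrD//.
Qed.

Lemma measurable_fun_row N (D : set 'rV[R]_N) (f : 'rV[R]_N -> R) : open D ->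
  (forall x, D x -> {for x, continuous f}) ->
  measurable_fun [set t : N.-tuple mR | D (row_of t)] (fun t => f (row_of t)).
Proof.
move=> oD cf; apply: (measurability _ (RGenOInfty.measurableE R)).
move=> _ [_ [a ->] <-].
rewrite (_ : _ `&` _ = [set t : N.-tuple mR | (D `&` [set x | a < f x]) (row_of t)]).
  apply: measurable_open_row; rewrite openE => x [Dx ax].
  rewrite /interior; apply: filterI; first exact: open_nbhs_nbhs.
  exact: (@cvgr_gt _ _ _ _ f (f x) (cf x Dx)).
by apply/seteqP; split=> t /=; rewrite in_itv/= andbT.
Qed.

(** Tonelli, one coordinate at a time along the recursion that defines the measure. *)
Lemma integral_tensor N (c : 'I_N -> R -> R) (I : 'I_N -> R) :
  (forall j t, 0 <= c j t) -> (forall j, measurable_fun [set: mR] (c j)) ->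
  (forall j, \int[@lebesgue_measure R]_t (c j t)%:E = (I j)%:E)%E ->
  (\int[mu N]_t (\prod_j c j (tnth t j))%:E = (\prod_j I j)%:E)%E.
Proof.
elim: N c I => [|N IH] c I c0 mc cI.
  rewrite /= big_ord0. under eq_integral do rewrite big_ord0.
  rewrite integral_cst//= mul1e. exact: diracT.
rewrite [mu N.+1]/=.
have mP n (d : 'I_n -> R -> R) : (forall j, measurable_fun [set: mR] (d j)) ->
   measurable_fun [set: n.-tuple mR] (fun t => \prod_j d j (tnth t j)).
  move=> md; apply: measurable_prod => j _.
  by apply: measurableT_comp => //; exact: measurable_tnth.
rewrite /lebesgue_step ge0_integral_pushforward//=; first last.
- by move=> t _; rewrite lee_fin prodr_ge0.
- by apply/measurable_EFinP; exact: mP.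
- exact: measurable_tuple_cons.
rewrite fubini_tonelli1/=; first last.
- by move=> t; rewrite lee_fin prodr_ge0.
- apply/measurable_EFinP; apply: (measurableT_comp (mP _ _ mc)).
  exact: measurable_tuple_cons.
rewrite /fubini_F /=.
transitivity (\int[@lebesgue_measure R]_x ((c ord0 x) * (\prod_j I (lift ord0 j)))%:E)%E.
  apply: eq_integral => x _.
  transitivity (\int[mu N]_t ((c ord0 x)%:E *
    (\prod_(j < N) c (lift ord0 j) (tnth t j))%:E))%E.
    apply: eq_integral => t _; rewrite big_ord_recl /= tnth0.
    by under eq_bigr do rewrite tnthS.
  rewrite ge0_integralZl_EFin//; last first.
  - by apply/measurable_EFinP; exact: (mP _ (fun j => c (lift ord0 j))).
  - by move=> t _; rewrite lee_fin prodr_ge0.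
  by rewrite (IH (fun j => c (lift ord0 j)) (fun j => I (lift ord0 j)))// EFinM.
have I0 j : 0 <= I j.
  by rewrite -lee_fin -cI integral_ge0// => t _; rewrite lee_fin.
under eq_integral do rewrite EFinM.
rewrite ge0_integralZr//; last 3 first.
- by apply/measurable_EFinP.
- by move=> x _; rewrite lee_fin.
- by rewrite lee_fin prodr_ge0.
by rewrite cI big_ord_recl EFinM.
Qed.

Definition cube N (x : 'rV[R]_N) (r : R) : set (N.-tuple mR) :=
  [set t : N.-tuple mR | `|row_of t - x| <= r].

Lemma measurable_cube N (x : 'rV[R]_N) (r : R) : measurable (cube x r).
Proof.
rewrite -[cube x r]setCK; apply: measurableC.
apply: (@measurable_open_row _ (~` [set y | `|y - x| <= r])).
apply: closed_openC; rewrite (_ : mkset _ = closed_ball_ Num.norm x r);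
  first exact: closed_closed_ball_.
by apply/seteqP; split=> y /=; rewrite /closed_ball_ /= distrC.
Qed.

(** The norm of row vectors is the sup norm, so its balls are products of intervals. *)
Lemma cubeE N (x : 'rV[R]_N) (r : R) (t : N.-tuple mR) : 0 <= r ->
  \1_(cube x r) t = \prod_j (\1_(`[x 0 j - r, x 0 j + r]%classic) (tnth t j)) :> R.
Proof.
move=> r0; rewrite indicE.
case: (boolP (t \in cube x r)); rewrite ?inE ?notin_setE /cube /= => H.
  rewrite big1// => j _; rewrite indicE mem_set//= in_itv/= -ler_distlC distrC.
  by have := coord_le_norm (row_of t - x) j; rewrite !mxE => /le_trans; apply.
have [j Hj] : exists j, r < `|tnth t j - x 0 j|.
  apply/not_existsP => K; apply: H; apply: norm_rV_le => // j.
  by rewrite !mxE leNgt; apply/negP/K.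
rewrite (bigD1 j)//= indicE memNset ?mul0r//=.
by rewrite in_itv/= -ler_distlC distrC; apply/negP; rewrite -ltNge.
Qed.

Lemma mu_cube_finite N (x : 'rV[R]_N) (r : R) : 0 <= r -> (mu N (cube x r) < +oo)%E.
Proof.
move=> r0.
pose c (j : 'I_N) : R -> R := \1_(`[x 0 j - r, x 0 j + r]%classic).
rewrite -[X in mu N X]setIT -integral_indic//; last exact: measurable_cube.
under eq_integral do rewrite cubeE//.
rewrite (@integral_tensor _ c (fun=> Num.max 0 (2 * r))) ?ltry//.
- by move=> j; apply: measurable_indic; exact: measurable_itv.
- move=> j; rewrite /c integral_indic//.
  rewrite setIT [LHS]lebesgue_measure_itv/= lte_fin.
  case: ifPn => h; rewrite -?EFinB; congr EFin; rewrite /Num.max; case: ifPn => h'; lra.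
Qed.

Lemma cube_integrable N (x : 'rV[R]_N) (r : R) (f : N.-tuple mR -> R) (B : R) :
  0 <= r -> measurable_fun (cube x r) f -> (forall t, cube x r t -> `|f t| <= B) ->
  (mu N).-integrable (cube x r) (EFin \o f).
Proof.
move=> r0 mf fB; apply: measurable_bounded_integrable => //.
- exact: measurable_cube.
- exact: mu_cube_finite.
- by exists B; split; rewrite ?num_real// => M BM t /= /fB /le_trans; apply; exact: ltW.
Qed.

Section mass.
Variables (b : R -> R).
Hypotheses (bc : continuous b) (b0 : forall t, 0 <= b t) (bp : 0 < b 0)
  (bs : forall t, 1 <= `|t| -> b t = 0).

Lemma bump_integral : exists I : R, 0 < I /\ (\int[@lebesgue_measure R]_t (b t)%:E = I%:E)%E.
Proof.
have mb : measurable_fun [set: mR] b by exact: continuous_measurable_fun.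
have bint : (@lebesgue_measure R).-integrable `[-1, 1]%classic (EFin \o b).
  apply: continuous_compact_integrable; first exact: segment_compact.
  exact: continuous_subspaceT.
have E : (\int[@lebesgue_measure R]_t (b t)%:E =
  \int[@lebesgue_measure R]_(t in `[(-1)%R, 1%R]) (b t)%:E)%E.
  rewrite [RHS]integral_mkcond; apply: eq_integral => t _; rewrite patchE.
  case: ifPn => //; rewrite notin_setE /= in_itv/= -ler_norml => /negP; rewrite -ltNge =>
    /ltW/bs -> //.
have fin : (\int[@lebesgue_measure R]_t (b t)%:E \is a fin_num)%E.
  by rewrite E; apply: integrable_fin_num.
exists (fine (\int[@lebesgue_measure R]_t (b t)%:E)); split; last by rewrite fineK.
rewrite -lte_fin fineK//.
have [d d0 Hd] : exists2 d : R, 0 < d & forall t, `|t| <= d -> b 0 / 2 <= b t.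
  have bc0 : {for (0 : R), continuous b} by exact: bc.
  have b02 : 0 < b 0 / 2 by rewrite divr_gt0.
  have /cvgrPdist_le/(_ _ b02)/nbhs_ballP[e /= e0 He] := bc0.
  exists (e / 2); first lra.
  move=> t td; have := He t; rewrite /ball/= sub0r normrN => /(_ ltac:(lra)).
  by rewrite ler_norml; lra.
apply: (@lt_le_trans _ _ (\int[@lebesgue_measure R]_(t in `[(- d)%R, d]) (b 0 / 2)%:E)%E).
  rewrite integral_cst//= lebesgue_measure_itv/= lte_fin ifT; last lra.
  by rewrite -EFinB -EFinM lte_fin opprK mulr_gt0 ?divr_gt0 ?addr_gt0.
apply: (@le_trans _ _ (\int[@lebesgue_measure R]_(t in `[(- d)%R, d]) (b t)%:E)%E).
  apply: ge0_le_integral => //=.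
  - by move=> t _; rewrite lee_fin ltW// divr_gt0.
  - by apply/measurable_EFinP; exact: measurable_funTS.
  - by move=> t; rewrite in_itv/= -ler_norml lee_fin => /Hd.
apply: ge0_subset_integral => //=.
- by apply/measurable_EFinP.
- by move=> t _; rewrite lee_fin.
Qed.

Lemma scaled_integral (I a e : R) : 0 < e ->
  (\int[@lebesgue_measure R]_t (b t)%:E = I%:E)%E ->
  (\int[@lebesgue_measure R]_t (b ((t - a) / e))%:E = (e * I)%:E)%E.
Proof.
move=> e0 bI.
pose F (t : R) : R := (t - a) / e.
have dF (t : R) : is_derive t (1 : R) F e^-1.
  by apply: is_derive_eq; rewrite /GRing.scale/=; ring.
have F' : derive1 F = cst e^-1.
  by apply/funext => t; rewrite derive1E (@derive_val _ _ _ _ _ _ _ (dF t)).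
have bF : continuous (b \o F).
  move=> t; apply: continuous_comp; last exact: bc.
  by apply/differentiable_continuous/derivable1_diffP; case: (dF t).
have := @increasing_ge0_integration_by_substitutionT R F b.
rewrite F' bI => H.
have {}H : (I%:E = \int[@lebesgue_measure R]_x ((b (F x))%:E * (e^-1)%:E))%E.
  apply: H => //.
  - by move=> x y xy; rewrite /F ltr_pM2r ?invr_gt0// ltrD2r.
  - by move=> t; exact: cst_continuous.
  - exact: is_cvg_cst.
  - exact: is_cvg_cst.
  - apply/cvgrNyPle => A; exists (A * e + a); split; rewrite ?num_real// => t /ltW ta.
    by rewrite /F ler_pdivrMr// lerBlDr.
  - apply/cvgryPge => A; exists (A * e + a); split; rewrite ?num_real// => t /ltW ta.
    by rewrite /F ler_pdivlMr// lerBrDr.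
move: H; rewrite ge0_integralZr//; last 3 first.
- by apply/measurable_EFinP; exact: continuous_measurable_fun.
- by move=> t _; rewrite lee_fin.
- by rewrite lee_fin invr_ge0 ltW.
move=> H; rewrite EFinM H muleC -muleA -EFinM mulVf ?mule1// gt_eqF//.
Qed.

(** The mass is the same for all centres [x]: convolution with these functions
    multiplies constants by [m], up to which it approximates the identity. *)
Lemma tensor_mass N (e : R) : 0 < e -> exists m : R, 0 < m /\ forall x : 'rV[R]_N,
  (\int[mu N]_t (\prod_j b ((tnth t j - x 0 j) / e))%:E = m%:E)%E.
Proof.
move=> e0; have [I [I0 HI]] := bump_integral.
exists (\prod_(j < N) (e * I)); split; first by apply: prodr_gt0 => j _; rewrite mulr_gt0.
move=> x; apply: (@integral_tensor N (fun j s => b ((s - x 0 j) / e))) => //.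
- move=> j; apply: continuous_measurable_fun => t; apply: continuous_comp; last exact: bc.
  by apply: cvgM; [apply: cvgB => //; exact: cvg_cst|exact: cvg_cst].
- by move=> j; exact: scaled_integral.
Qed.

End mass.

End tuple_measure.

(** * Derivatives of tensor products *)

Section onedim.
Context {R : realType}.
Variable b : nat -> R -> R.
Hypotheses (bd : forall k (t : R), is_derive t (1 : R) (b k) (b k.+1 t))
  (bs : forall k t, 1 <= `|t| -> b k t = 0).

Lemma derivs_continuous k : continuous (b k).
Proof.
by move=> t; apply/differentiable_continuous/derivable1_diffP; case: (bd k t).
Qed.

Lemma derivs_bounded k : exists C : R, 0 <= C /\ forall t, `|b k t| <= C.
Proof.
have := @EVT_max R (fun t => `|b k t|) (-1) 1.
case; first lra.
  apply: continuous_subspaceT => t; apply: cvg_norm; exact: derivs_continuous.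
move=> c _ H; exists `|b k c|; split=> // t.
have [t1|t1] := leP 1 `|t|; first by rewrite bs// normr0.
by apply: H; rewrite in_itv/= -ler_norml ltW.
Qed.

End onedim.

Lemma mvt_bound {R : realType} (f df : R -> R) (K t : R) : 0 <= t ->
  (forall s : R, 0 <= s <= t -> is_derive s (1 : R) f (df s)) ->
  (forall s, 0 <= s <= t -> `|df s| <= K) -> `|f t - f 0| <= K * t.
Proof.
move=> t0 fd dK.
have cf : {within `[0, t], continuous f}.
  apply: continuous_in_subspaceT => s; rewrite inE/= in_itv/= => st.
  apply/differentiable_continuous/derivable1_diffP.
  by case: (fd s st).
have fd' s : s \in `]0, t[ -> is_derive s (1 : R) f (df s).
  by rewrite in_itv/= => /andP[s0 st]; apply: fd; rewrite !ltW.
have [c cab ->] := @MVT_segment R f df 0 t t0 fd' cf.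
rewrite subr0 normrM (ger0_norm t0) ler_wpM2r// dK//.
Qed.

(** The bound on the third derivative makes the error uniform in [a], so that the
    estimate survives integration against a bounded function. *)
Lemma second_difference_bound {R : realType} (f f1 f2 f3 : R -> R) (C : R) :
  (forall s : R, is_derive s (1 : R) f (f1 s)) ->
  (forall s : R, is_derive s (1 : R) f1 (f2 s)) ->
  (forall s : R, is_derive s (1 : R) f2 (f3 s)) ->
  (forall s, `|f3 s| <= C) ->
  forall a t : R, 0 <= t ->
    `|f (a + t) + f (a - t) - 2 * f a - t ^+ 2 * f2 a| <= 2 * C * t ^+ 3.
Proof.
move=> d0 d1 d2 d3 a t t0.
have shp (g g' : R -> R) : (forall s : R, is_derive s (1 : R) g (g' s)) ->
   forall s : R, is_derive s (1 : R) (fun s => g (a + s)) (g' (a + s)).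
  move=> gd s.
  have e1 : is_derive s (1 : R) (fun s : R => a + s) 1.
    by apply: is_derive_eq; ring.
  by have := @is_derive1_comp R g _ s _ _ (gd _) e1; rewrite mulr1.
have shm (g g' : R -> R) : (forall s : R, is_derive s (1 : R) g (g' s)) ->
   forall s : R, is_derive s (1 : R) (fun s => g (a - s)) (- g' (a - s)).
  move=> gd s.
  have e1 : is_derive s (1 : R) (fun s : R => a - s) (-1).
    by apply: is_derive_eq; ring.
  by have := @is_derive1_comp R g _ s _ _ (gd _) e1; rewrite mulrN1.
have B2 s : 0 <= s -> `|f2 (a + s) + f2 (a - s) - 2 * f2 a| <= 2 * C * s.
  move=> s0.
  have P := mvt_bound s0 (fun r _ => shp _ _ d2 r) (fun r _ => d3 (a + r)).
  have M := mvt_bound s0 (fun r _ => shm _ _ d2 r) (fun r _ =>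
    ltac:(rewrite normrN; exact: d3)).
  rewrite addr0 in P; rewrite subr0 in M.
  rewrite (_ : f2 (a + s) + _ - _ = (f2 (a + s) - f2 a) + (f2 (a - s) - f2 a)); last ring.
  by apply: (le_trans (ler_normD _ _)); rewrite mulr2n !mulrDl mul1r lerD.
have B1 s : 0 <= s -> `|f1 (a + s) - f1 (a - s) - 2 * s * f2 a| <= 2 * C * s ^+ 2.
  move=> s0.
  pose q r := f1 (a + r) - f1 (a - r) - 2 * r * f2 a.
  have qd r : is_derive r (1 : R) q (f2 (a + r) + f2 (a - r) - 2 * f2 a).
    have e1 := shp _ _ d1 r; have e2 := shm _ _ d1 r.
    by rewrite /q; apply: is_derive_eq; rewrite /GRing.scale/=; ring.
  have := @mvt_bound R q _ (2 * C * s) s s0 (fun r _ => qd r).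
  rewrite /q addr0 subr0 mulr0 mul0r subr0 subrr subr0 expr2 mulrA; apply.
  move=> r /andP[r0 rs]; apply: (le_trans (B2 _ r0)); rewrite ler_wpM2l//.
  by rewrite mulr_ge0// (le_trans _ (d3 0)).
pose p r := f (a + r) + f (a - r) - 2 * f a - r ^+ 2 * f2 a.
have pd r : is_derive r (1 : R) p (f1 (a + r) - f1 (a - r) - 2 * r * f2 a).
  have e1 := shp _ _ d0 r; have e2 := shm _ _ d0 r.
  by rewrite /p; apply: is_derive_eq; rewrite /GRing.scale/=; ring.
have := @mvt_bound R p _ (2 * C * t ^+ 2) t t0 (fun r _ => pd r).
have -> : p 0 = 0 by rewrite /p addr0 subr0; ring.
rewrite subr0 -(mulrA (2 * C)) -exprSr; apply.
move=> r /andP[r0 rs]; apply: (le_trans (B1 _ r0)); rewrite ler_wpM2l//.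
  by rewrite mulr_ge0// (le_trans _ (d3 0)).
by rewrite lerXn2r// nnegrE.
Qed.

(** Replace one factor at a time. *)
Lemma norm_prodB {R : realType} (I : Type) (s : seq I) (f g : I -> R) (B d : R) :
  1 <= B -> (forall i, `|f i| <= B) -> (forall i, `|g i| <= B) ->
  (forall i, `|f i - g i| <= d) ->
  `|\prod_(i <- s) f i - \prod_(i <- s) g i| <= (size s)%:R * B ^+ size s * d.
Proof.
move=> B1 fB gB fg.
elim: s => [|i s IH]; first by rewrite !big_nil subrr normr0 !mul0r.
have B0 : 0 <= B by rewrite (le_trans _ B1).
have d0 : 0 <= d by rewrite (le_trans _ (fg i)).
have gs : `|\prod_(j <- s) g j| <= B ^+ size s.
  elim: (s) => [|j r IH']; first by rewrite big_nil normr1.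
  by rewrite big_cons normrM exprS ler_pM.
rewrite !big_cons.
set F := \prod_(j <- s) f j; set G := \prod_(j <- s) g j.
rewrite (_ : f i * F - g i * G = f i * (F - G) + (f i - g i) * G); last ring.
apply: (le_trans (ler_normD _ _)); rewrite !normrM.
apply: (@le_trans _ _ (B * ((size s)%:R * B ^+ size s * d) + d * B ^+ (size s).+1)).
  apply: lerD; first by apply: ler_pM.
  apply: ler_pM => //; apply: (le_trans gs).
  by rewrite ler_weXn2l.
rewrite /= -[in leRHS]natr1 exprS le_eqVlt; apply/orP; left; apply/eqP; ring.
Qed.

Section tensor_products.
Context {R : realType} {N : nat}.
Implicit Types (x y : 'rV[R]_N) (B : 'I_N -> nat -> R -> R) (m : 'I_N -> nat).

(** [B j k] is meant to be the [k]-th derivative of a function [B j 0] of the [j]-th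
    coordinate; the multi-index [m] tells how often each factor is differentiated. *)
Definition tensor B m y : R := \prod_j B j (m j) (y 0 j).

Definition incr_order (i : 'I_N) m : 'I_N -> nat := fun j => (m j + (j == i))%N.

Lemma tensor_continuous B m : (forall j k, continuous (B j k)) -> continuous (tensor B m).
Proof.
move=> cB; rewrite /tensor.
apply: (@continuous_big R _ _ _ _ _ _ _ (fun j (y : 'rV[R]_N) => B j (m j) (y 0 j))).
  by move=> p; exact: mul_continuous.
move=> j _ y; apply: continuous_comp; last exact: cB.
exact: coord_continuous.
Qed.

Lemma coordDdelta x i j (t : R) : (x + t *: delta_mx 0 i) 0 j = x 0 j + t * (j == i)%:R.
Proof. by rewrite !mxE eqxx. Qed.

Lemma is_derive_tensor B m i y :
  (forall j k (t : R), is_derive t (1 : R) (B j k) (B j k.+1 t)) ->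
  is_derive y (delta_mx 0 i : 'rV[R]_N) (tensor B m) (tensor B (incr_order i m) y).
Proof.
move=> dB.
have Pi n (z : 'rV[R]_N) : (forall j, j != i -> z 0 j = y 0 j) ->
  (forall j, j != i -> n j = m j) ->
   tensor B n z = B i (n i) (z 0 i) * \prod_(j | j != i) B j (m j) (y 0 j).
  move=> H1 H2; rewrite /tensor (bigD1 i)//=; congr (_ * _).
  by apply: eq_bigr => j ji; rewrite H1// H2.
set P := \prod_(j | j != i) B j (m j) (y 0 j) in Pi.
have [dBi DBi] := dB i (m i) (y 0 i).
have L : h^-1 *: ((tensor B m \o shift y) (h *: delta_mx 0 i) - tensor B m y) @[h --> 0^']
   --> tensor B (incr_order i m) y.
  rewrite [X in _ --> X](Pi (incr_order i m))//; last first.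
    by move=> j ji; rewrite /incr_order (negbTE ji) addn0.
  rewrite /incr_order eqxx addn1.
  have Q : h^-1 *: ((B i (m i) \o shift (y 0 i)) (h *: (1 : R)) - B i (m i) (y 0 i)) * P
    @[h --> 0^']
     --> B i (m i).+1 (y 0 i) * P.
    apply: cvgMl; rewrite -DBi; exact: dBi.
  apply: cvg_trans Q; apply: near_eq_cvg; near=> h.
  rewrite /= (Pi m (_ + y))//; last first.
    by move=> j ji; rewrite addrC coordDdelta (negbTE ji) mulr0 addr0.
  rewrite [h *: delta_mx 0 i + y]addrC coordDdelta eqxx mulr1 (Pi m y)// -mulrBl
    /GRing.scale/= mulr1.
  by rewrite -mulrA [y 0 i + h]addrC.
apply: DeriveDef; first by apply/cvg_ex; exists (tensor B (incr_order i m) y).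
exact: cvg_lim L.
Unshelve. all: by end_near. Qed.

Lemma partial_tensor B m i : (forall j k (t : R), is_derive t (1 : R) (B j k) (B j k.+1 t)) ->
  partial i (tensor B m) = tensor B (incr_order i m).
Proof.
move=> dB; apply/funext => y; rewrite /partial.
exact: (@derive_val _ _ _ _ _ _ _ (is_derive_tensor m i y dB)).
Qed.

Lemma Ck_tensor B m k : (forall j k (t : R), is_derive t (1 : R) (B j k) (B j k.+1 t)) ->
  Ck k setT (tensor B m).
Proof.
move=> dB.
have cB : forall j k, continuous (B j k) by move=> j; apply: derivs_continuous => k' t;
  exact: dB.
elim: k m => [|k IH] m /=; first by move=> x _; exact: tensor_continuous.
split; first by move=> x _; exact: tensor_continuous.
move=> i; split; last by rewrite partial_tensor.
by move=> x _; case: (is_derive_tensor m i x dB).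
Qed.

Lemma laplacian_tensor B m y : (forall j k (t : R), is_derive t (1 : R) (B j k) (B j k.+1 t))
  ->
  laplacian (tensor B m) y = \sum_i tensor B (incr_order i (incr_order i m)) y.
Proof.
by move=> dB; rewrite /laplacian; apply: eq_bigr => i _; rewrite !partial_tensor.
Qed.

End tensor_products.

(** * Mollifiers *)

Section mollifiers.
Context {R : realType} {N : nat}.
Variable b : nat -> R -> R.
Hypotheses (bd : forall k (t : R), is_derive t (1 : R) (b k) (b k.+1 t))
  (bs : forall k t, 1 <= `|t| -> b k t = 0)
  (b0 : forall t, 0 <= b 0 t).
Variable e : R.
Hypothesis e0 : 0 < e.
Implicit Types (x y : 'rV[R]_N) (t : R).

Let eV0 : 0 <= e^-1. Proof. by rewrite invr_ge0 ltW. Qed.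

(** The powers of [1/e] are those of the chain rule: this is the sequence of derivatives
    of [t |-> b 0 ((t - x_j) / e)]. *)
Definition factor x (j : 'I_N) (k : nat) (t : R) : R := e^-1 ^+ k * b k ((t - x 0 j) / e).

Lemma is_derive_factor x j k (t : R) : is_derive t (1 : R) (factor x j k) (factor x j k.+1 t).
Proof.
have d1 : is_derive t (1 : R) (fun t : R => (t - x 0 j) / e) e^-1.
  by apply: is_derive_eq; rewrite /GRing.scale/=; ring.
have d2 := @is_derive1_comp R (b k) _ t _ _ (bd k _) d1.
rewrite /factor exprSr.
have -> : (fun t0 => e^-1 ^+ k * b k ((t0 - x 0 j) / e)) = e^-1 ^+ k \*:
  (b k \o (fun t : R => (t - x 0 j) / e)).
  by apply/funext.
apply: is_derive_eq. rewrite /GRing.scale/=; ring.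
Qed.

Definition mollifier x y : R := tensor (factor x) (fun=> 0%N) y.
(** The second derivative in the [i]-th coordinate of [y]. It is also the one in the
    [i]-th coordinate of the centre [x], because the mollifier depends on [y - x]
    only. *)
Definition mollifier_dd (i : 'I_N) x y : R := tensor (factor x)
  (incr_order i (incr_order i (fun=> 0%N))) y.

Lemma mollifierE x y : mollifier x y = \prod_j b 0 ((y 0 j - x 0 j) / e).
Proof. by apply: eq_bigr => j _; rewrite /factor expr0 mul1r. Qed.

Lemma mollifier_ge0 x y : 0 <= mollifier x y.
Proof. by rewrite mollifierE prodr_ge0. Qed.

Lemma mollifier_ddE i x y : mollifier_dd i x y =
  e^-1 ^+ 2 * b 2 ((y 0 i - x 0 i) / e) * \prod_(j | j != i) b 0 ((y 0 j - x 0 j) / e).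
Proof.
rewrite /mollifier_dd /tensor (bigD1 i)//= /incr_order eqxx /factor; congr (_ * _).
by apply: eq_bigr => j /negbTE ->; rewrite expr0 mul1r.
Qed.

Lemma tensor_factor_supp x m y : e <= `|y - x| -> tensor (factor x) m y = 0.
Proof.
move=> yx.
have [j Hj] : exists j, e <= `|y 0 j - x 0 j|.
  apply/not_existsP => K.
  have : `|y - x| < e.
    by apply: norm_rV_lt => // j; rewrite !mxE ltNge; apply/negP/K.
  by rewrite ltNge yx.
rewrite /tensor (bigD1 j)//= /factor bs ?mulr0 ?mul0r//.
by rewrite normrM normfV (gtr0_norm e0) ler_pdivlMr// mul1r.
Qed.

Lemma mollifier_test (D : set 'rV[R]_N) x : (forall y, `|y - x| <= e -> D y) ->
  test_function D (mollifier x).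
Proof.
move=> HD.
have cl : closed [set y | `|y - x| <= e].
  rewrite (_ : mkset _ = closed_ball_ Num.norm x e); first exact: closed_closed_ball_.
  by apply/seteqP; split=> y /=; rewrite /closed_ball_ /= distrC.
have sub : closure [set y | mollifier x y != 0] `<=` [set y | `|y - x| <= e].
  rewrite [X in _ `<=` X](closure_id _).1//; apply: closure_subset => y /=.
  by apply: contraNle => /ltW/tensor_factor_supp; rewrite /mollifier => ->.
split; last by move=> y /sub /HD.
- by move=> k; apply: Ck_tensor => j k' t; exact: is_derive_factor.
- apply: bounded_closed_compact; last exact: closed_closure.
  exists (`|x| + e); split; rewrite ?num_real// => M xM y /sub /= yx.
  rewrite -(subrK x y); apply: (le_trans (ler_normD _ _)).
  by rewrite addrC; apply: (le_trans _ (ltW xM)); rewrite lerD2l.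
Qed.

Lemma laplacian_mollifier x y : laplacian (mollifier x) y = \sum_i mollifier_dd i x y.
Proof. by apply: laplacian_tensor => j k t; exact: is_derive_factor. Qed.

(** Here the centre moves: this is the kernel of a second difference of the
    convolution. *)
Lemma mollifier_second_diff i : exists K, 0 <= K /\ forall x y t, 0 <= t ->
  `|mollifier (x + t *: delta_mx 0 i) y + mollifier (x - t *: delta_mx 0 i) y - 2 * mollifier
    x y
    - t ^+ 2 * mollifier_dd i x y| <= K * t ^+ 3.
Proof.
have [C [C0 HC]] := derivs_bounded bd bs 0.
have [C3 [C30 HC3]] := derivs_bounded bd bs 3.
exists ((\prod_(j < N | j != i) C) * (2 * C3 * e^-1 ^+ 3)); split.
  by rewrite mulr_ge0 ?prodr_ge0// mulr_ge0 ?exprn_ge0// mulr_ge0.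
move=> x y t t0.
have P z s : z = x + s *: delta_mx 0 i -> mollifier z y = b 0 ((y 0 i - x 0 i) / e - s / e) *
  \prod_(j | j != i) b 0 ((y 0 j - x 0 j) / e).
  move=> ->; rewrite mollifierE (bigD1 i)//= coordDdelta eqxx mulr1; congr (_ * _).
    by congr (b 0 _); ring.
  by apply: eq_bigr => j /negbTE ji; rewrite coordDdelta ji mulr0 addr0.
rewrite (P _ t)// (P (x - _) (- t)) ?scaleNr// (P x 0) ?scale0r ?addr0// mollifier_ddE.
set a := (y 0 i - x 0 i) / e; set p := \prod_(j | j != i) _.
rewrite (_ : _ - _ = p * (b 0 (a + t / e) + b 0 (a - t / e) - 2 * b 0 a - (t / e) ^+ 2 * b 2
  a)); last first.
  by rewrite mulNr opprK mul0r subr0 expr_div_n exprVn; ring.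
rewrite normrM -[leRHS]mulrA; apply: ler_pM => //.
  by rewrite /p normr_prod; apply: ler_prod => j _; rewrite normr_ge0/=.
have te : 0 <= t / e by rewrite divr_ge0// ltW.
apply: (le_trans (second_difference_bound (bd 0) (bd 1) (bd 2) HC3 a te)).
by rewrite expr_div_n exprVn -[leRHS]mulrA [_^-1 * _]mulrC.
Qed.

Lemma mollifier_lipschitz : exists L, 0 <= L /\ forall x x' y,
  `|mollifier x y - mollifier x' y| <= L * `|x - x'|.
Proof.
have [C [C0 HC]] := derivs_bounded bd bs 0.
have [C1 [C10 HC1]] := derivs_bounded bd bs 1.
have lip1 s t : s <= t -> `|b 0 t - b 0 s| <= C1 * (t - s).
  move=> st.
  have st0 : 0 <= t - s by rewrite subr_ge0.
  have d r : is_derive r (1 : R) (fun r => b 0 (s + r)) (b 1 (s + r)).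
    have e1 : is_derive r (1 : R) (fun r : R => s + r) 1 by apply: is_derive_eq; ring.
    by have := @is_derive1_comp R (b 0) _ r _ _ (bd 0 _) e1; rewrite mulr1.
  by have := mvt_bound st0 (fun r _ => d r) (fun r _ => HC1 (s + r)); rewrite addr0 subrKC.
have lip s t : `|b 0 t - b 0 s| <= C1 * `|t - s|.
  have [st|/ltW ts] := leP s t; first by rewrite [`|t - s|]ger0_norm ?subr_ge0// lip1.
  by rewrite distrC [`|t - s|]distrC [`|s - t|]ger0_norm ?subr_ge0// lip1.
pose B := 1 + C.
exists (N%:R * B ^+ N * (C1 / e)); split.
  by rewrite !mulr_ge0 ?invr_ge0 ?exprn_ge0// ?addr_ge0// ltW.
move=> x x' y; rewrite !mollifierE.
have := @norm_prodB R _ (index_enum 'I_N) (fun j => b 0 ((y 0 j - x 0 j) / e))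
  (fun j => b 0 ((y 0 j - x' 0 j) / e)) B (C1 / e * `|x - x'|).
have -> : size (index_enum 'I_N) = N by rewrite -[RHS]card_ord cardE enumT.
rewrite [X in _ -> _ -> _ -> _ -> _ <= X]mulrA; apply.
- by rewrite /B lerDl.
- by move=> j; rewrite /B (le_trans (HC _))// lerDr.
- by move=> j; rewrite /B (le_trans (HC _))// lerDr.
- move=> j; apply: (le_trans (lip _ _)); rewrite -mulrA ler_wpM2l//.
  rewrite -mulrBl (_ : y 0 j - x 0 j - (y 0 j - x' 0 j) = - (x - x') 0 j);
    last by rewrite !mxE; ring.
  by rewrite mulNr normrN normrM normfV (gtr0_norm e0) mulrC ler_wpM2l// coord_le_norm.
Qed.

End mollifiers.

(** * Integrals over cubes *)

Section cube_integrals.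
Context {R : realType} {N : nat}.
Local Notation mR := (measurableTypeR R).
Local Notation mu := (lebesgue_measure_tuple R N).
Variables (x0 : 'rV[R]_N) (q : R).
Hypothesis q0 : 0 <= q.
Implicit Types (f g : 'rV[R]_N -> R).

(** Preferred to integrability on the cube because it is stable under products. *)
Definition bounded_measurable f := measurable_fun (cube x0 q) (fun t => f (row_of t)) /\
  exists B : R, forall y, `|y - x0| <= q -> `|f y| <= B.

Definition cube_integral f : R := (\int[mu]_(t in cube x0 q) f (row_of t))%R.

Lemma bounded_measurable_integrable f : bounded_measurable f ->
  mu.-integrable (cube x0 q) (EFin \o (fun t => f (row_of t))).
Proof. by move=> [mf [B fB]]; apply: (cube_integrable q0 mf (B := B)) => t; exact: fB. Qed.

Lemma closed_norm_ball : closed [set y : 'rV[R]_N | `|y - x0| <= q].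
Proof.
rewrite (_ : mkset _ = closed_ball_ Num.norm x0 q); first exact: closed_closed_ball_.
by apply/seteqP; split=> y /=; rewrite /closed_ball_ /= distrC.
Qed.

Lemma compact_norm_ball : compact [set y : 'rV[R]_N | `|y - x0| <= q].
Proof.
apply: bounded_closed_compact; last exact: closed_norm_ball.
exists (`|x0| + q); split; rewrite ?num_real// => M xM y /= yx.
rewrite -(subrK x0 y); apply: (le_trans (ler_normD _ _)).
by rewrite addrC; apply: (le_trans _ (ltW xM)); rewrite lerD2l.
Qed.

Lemma bounded_measurable_cont (D : set 'rV[R]_N) f : open D ->
  (forall y, `|y - x0| <= q -> D y) ->
  (forall x, D x -> {for x, continuous f}) -> bounded_measurable f.
Proof.
move=> oD HD cf; split.
  apply: (@measurable_funS _ _ _ _ [set t : N.-tuple mR | D (row_of t)]) => //.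
  - exact: measurable_open_row.
  - by move=> t; exact: HD.
  - exact: measurable_fun_row.
have K0 : [set y : 'rV[R]_N | `|y - x0| <= q] !=set0 by exists x0; rewrite /= subrr normr0.
have cK : {within [set y : 'rV[R]_N | `|y - x0| <= q], continuous (fun y => `|f y|)}.
  by apply: continuous_in_subspaceT => y /set_mem /HD /cf cy; apply: (continuous_comp cy);
    exact: norm_continuous.
have [c _ H] := EVT_max_rV K0 compact_norm_ball cK.
by exists `|f c| => y yq; apply: H; rewrite inE.
Qed.

Lemma bounded_measurableM f g : bounded_measurable f -> bounded_measurable g ->
  bounded_measurable (fun y => f y * g y).
Proof.
move=> [mf [B fB]] [mg [B' gB]]; split; first exact: measurable_funM.
by exists (B * B') => y yq; rewrite normrM ler_pM ?fB ?gB.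
Qed.

Lemma bounded_measurableD f g : bounded_measurable f -> bounded_measurable g ->
  bounded_measurable (fun y => f y + g y).
Proof.
move=> [mf [B fB]] [mg [B' gB]]; split; first exact: measurable_funD.
by exists (B + B') => y yq; rewrite (le_trans (ler_normD _ _))// lerD ?fB ?gB.
Qed.

Lemma bounded_measurable_cst (k : R) : bounded_measurable (fun=> k).
Proof. by split; [exact: measurable_cst|exists `|k|]. Qed.

Lemma cube_integralD f g : bounded_measurable f -> bounded_measurable g ->
  cube_integral (fun y => f y + g y) = cube_integral f + cube_integral g.
Proof. by move=> /bounded_measurable_integrable ? /bounded_measurable_integrable ?;
  rewrite /cube_integral RintegralD//; exact: measurable_cube. Qed.

Lemma cube_integralZ k f : bounded_measurable f -> cube_integral (fun y => k * f y) =
  k * cube_integral f.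
Proof. by move=> /bounded_measurable_integrable ?; rewrite /cube_integral RintegralZl//;
  exact: measurable_cube. Qed.

Lemma cube_integral_le f g : bounded_measurable f -> bounded_measurable g ->
  (forall y, `|y - x0| <= q -> f y <= g y) ->
  cube_integral f <= cube_integral g.
Proof.
by move=> /bounded_measurable_integrable ? /bounded_measurable_integrable ? fg;
  apply: le_Rintegral => //; [exact: measurable_cube|move=> t; exact: fg].
Qed.

Lemma cube_integral_abs f g : bounded_measurable f -> bounded_measurable g ->
  (forall y, `|y - x0| <= q -> `|f y| <= g y) ->
  `|cube_integral f| <= cube_integral g.
Proof.
move=> af ag fg; rewrite ler_norml; apply/andP; split; last first.
  by apply: cube_integral_le => // y yq; rewrite (le_trans (ler_norm _))// fg.
rewrite -mulN1r -cube_integralZ//; apply: cube_integral_le => //;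
  first exact: bounded_measurableM (bounded_measurable_cst _) ag.
by move=> y yq; rewrite mulN1r lerNl (le_trans _ (fg _ yq))// ler_normr lexx orbT.
Qed.

Lemma cube_integral_sum (I : Type) (s : seq I) (F : I -> 'rV[R]_N -> R) :
  (forall i, bounded_measurable (F i)) ->
  bounded_measurable (fun y => \sum_(i <- s) F i y) /\ cube_integral
    (fun y => \sum_(i <- s) F i y) = \sum_(i <- s) cube_integral (F i).
Proof.
move=> aF; elim: s => [|i s [IH1 IH2]].
  under eq_fun do rewrite big_nil; split; first exact: bounded_measurable_cst.
  by rewrite big_nil /cube_integral Rintegral_cst ?mul0r//; exact: measurable_cube.
under eq_fun do rewrite big_cons; split; first exact: bounded_measurableD.
by rewrite big_cons -IH2 -cube_integralD.
Qed.

Lemma integral_rV_cube (D : set 'rV[R]_N) f : (forall y, `|y - x0| <= q -> D y) ->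
  (forall y, q < `|y - x0| -> f y = 0) -> integral_rV D f = cube_integral f.
Proof.
move=> HD f0; rewrite /integral_rV /cube_integral Rintegral_mkcond [RHS]Rintegral_mkcond.
congr (Rintegral _ _ _); apply/funext => t; rewrite !patchE.
case: ifPn => Dt; case: ifPn => // ct.
- by rewrite f0//; move: ct; rewrite notin_setE /cube /= => /negP; rewrite -ltNge.
- by move: Dt; rewrite notin_setE/=; case; apply: HD; move: ct; rewrite inE.
Qed.

Lemma cube_integral_total f m : (forall y, 0 <= f y) -> (forall y, q < `|y - x0| -> f y = 0)
  ->
  (\int[mu]_t (f (row_of t))%:E = m%:E)%E -> cube_integral f = m.
Proof.
move=> f0 fs H; rewrite /cube_integral /Rintegral integral_mkcond.
rewrite (_ : (EFin \o _) \_ _ = (fun t => (f (row_of t))%:E)) ?H//.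
apply/funext => t; rewrite patchE; case: ifPn => // ct.
by rewrite fs//; move: ct; rewrite notin_setE /cube /= => /negP; rewrite -ltNge.
Qed.

End cube_integrals.

Lemma unif_cont_compact {R : realType} {N : nat} (K : set 'rV[R]_N) (u : 'rV[R]_N -> R)
  (eta : R) :
  compact K -> (forall x, K x -> {for x, continuous u}) -> 0 < eta ->
  \forall e \near 0^'+, forall x, K x -> forall y, `|y - x| <= e -> `|u y - u x| <= eta.
Proof.
move=> /compact_near_coveringP cK cu eta0.
have [] := cK R (0^'+ : set_system R) (fun e x => forall y, `|y - x| <= e -> `|u y - u x| <=
  eta).
  move=> x Kx.
  have eta2 : 0 < eta / 2 by rewrite divr_gt0.
  have /cvgrPdist_le/(_ _ eta2)/nbhs_ballP[d /= d0 Hd] := cu x Kx.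
  exists (ball x (d / 2), [set e | e < d / 2]) => /=.
    split; first by apply: nbhsx_ballx; rewrite divr_gt0.
    by apply: nbhs_right_lt; rewrite divr_gt0.
  move=> [x' e] /= [xx' ed] y yx'.
  rewrite -[u y - u x'](subrKA (u x)); apply: (le_trans (ler_normD _ _)).
  rewrite [leRHS](splitr eta); apply: lerD.
    rewrite distrC; apply: Hd; rewrite -ball_normE/= distrC.
    rewrite -(subrKA x'); apply: (le_lt_trans (ler_normD _ _)).
    rewrite [ltRHS](splitr d); apply: ler_ltD; first by rewrite (le_trans yx')// ltW.
    by move: xx'; rewrite -ball_normE/= distrC.
  apply: Hd; move: xx'; rewrite -!ball_normE/= => /lt_trans; apply.
  by rewrite ltr_pdivrMr// ltr_pMr// ltr1n.
by move=> d /= d0 Hd; exists d.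
Qed.

(** * Laplacians from second difference quotients *)

Section lap.
Context {R : realType} {N : nat}.
Implicit Types (f g : 'rV[R]_N -> R) (x y : 'rV[R]_N).

Definition second_quotient f (i : 'I_N) x (t : R) : R :=
  (f (x + t *: delta_mx 0 i) + f (x - t *: delta_mx 0 i) - 2 * f x) / t ^+ 2.

(** Difference quotients, rather than iterated derivatives, can be compared at an
    extremum and can be taken under an integral. They are even in [t], so a one-sided
    limit loses nothing. *)
Definition laplacian_at f x (l : R) : Prop :=
  exists2 c : 'I_N -> R, (forall i, second_quotient f i x t @[t --> 0^'+] --> c i) &
    \sum_i c i = l.

(** The Euclidean norm squared; [`|x|] is the sup norm. *)
Definition sqnorm x : R := \sum_j x 0 j ^+ 2.

Lemma sqnorm_ge0 x : 0 <= sqnorm x.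
Proof. by apply: sumr_ge0 => j _; rewrite sqr_ge0. Qed.

Lemma norm_sqnorm x : `|x| ^+ 2 <= sqnorm x.
Proof.
have H : `|x| <= Num.sqrt (sqnorm x).
  apply: norm_rV_le => [|j]; first exact: sqrtr_ge0.
  rewrite -sqrtr_sqr ler_sqrt ?sqnorm_ge0// /sqnorm (bigD1 j)//= lerDl.
  by apply: sumr_ge0 => k _; rewrite sqr_ge0.
by rewrite -[leRHS]sqr_sqrtr ?sqnorm_ge0// lerXn2r// nnegrE// sqrtr_ge0.
Qed.

Lemma sqnormN x : sqnorm (- x) = sqnorm x.
Proof. by apply: eq_bigr => j _; rewrite mxE sqrrN. Qed.

Lemma sqnorm_delta x i t : sqnorm (x + t *: delta_mx 0 i) = sqnorm x + 2 * t * x 0 i + t ^+ 2.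
Proof.
rewrite /sqnorm (bigD1 i)//= [in RHS](bigD1 i)//= coordDdelta eqxx mulr1.
under eq_bigr => j /negbTE ji do rewrite coordDdelta ji mulr0 addr0.
ring.
Qed.

Lemma sqnorm_cont : continuous sqnorm.
Proof.
apply: (@continuous_big R _ _ _ _ _ _ _ (fun j (y : 'rV[R]_N) => y 0 j ^+ 2)).
  by move=> p; exact: add_continuous.
move=> j _ y; apply: (@continuous_comp _ _ _ (fun y : 'rV[R]_N => y 0 j)
  (fun r : R => r ^+ 2)).
  exact: coord_continuous.
exact: exprn_continuous.
Qed.

Lemma second_quotientD f g i x t : second_quotient (fun y => f y + g y) i x t =
  second_quotient f i x t + second_quotient g i x t.
Proof. by rewrite /second_quotient -mulrDl; congr (_ / _); ring. Qed.

Lemma second_quotientZ f k i x t : second_quotient (fun y => k * f y) i x t =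
  k * second_quotient f i x t.
Proof. by rewrite /second_quotient [in RHS]mulrA; congr (_ / _); ring. Qed.

Lemma laplacian_atD f g x l k : laplacian_at f x l -> laplacian_at g x k ->
  laplacian_at (fun y => f y + g y) x (l + k).
Proof.
move=> [c Hc <-] [d Hd <-]; exists (fun i => c i + d i); last by rewrite big_split.
by move=> i; under eq_fun do rewrite second_quotientD; exact: cvgD.
Qed.

Lemma laplacian_atZ f x l k : laplacian_at f x l -> laplacian_at (fun y => k * f y) x (k * l).
Proof.
move=> [c Hc <-]; exists (fun i => k * c i); last by rewrite mulr_sumr.
by move=> i; under eq_fun do rewrite second_quotientZ; exact: cvgMr.
Qed.

Lemma laplacian_at_cst k x : laplacian_at (fun=> k) x 0.
Proof.
exists (fun=> 0); last by rewrite big1.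
move=> i; rewrite (_ : (fun t => _) = (fun=> 0)); first exact: cvg_cst.
by apply/funext => t /=; rewrite /second_quotient (_ : k + k - 2 * k = 0) ?mul0r//; ring.
Qed.

Lemma second_quotient_sqnorm x0 i x : second_quotient (fun y => sqnorm (y - x0)) i x t
  @[t --> 0^'+] --> (2 : R).
Proof.
apply: (@cvg_trans _ ((fun=> (2 : R)) @ 0^'+)); last exact: cvg_cst.
apply: near_eq_cvg; near=> t.
have t0 : t != 0 by rewrite gt_eqF//; near: t; exact: nbhs_right_gt.
rewrite /second_quotient (addrAC x) sqnorm_delta (addrAC x) -scaleNr sqnorm_delta.
by field.
Unshelve. all: by end_near. Qed.

Lemma laplacian_at_sqnorm x0 x : laplacian_at (fun y => sqnorm (y - x0)) x (2 * N%:R).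
Proof.
exists (fun=> 2); last by rewrite sumr_const card_ord mulr_natr.
by move=> i; exact: second_quotient_sqnorm.
Qed.

Lemma second_quotient_subZsqnorm f x0 i x k (c : R) : second_quotient f i x t @[t --> 0^'+]
  --> c ->
  second_quotient (fun y => f y - k * sqnorm (y - x0)) i x t @[t --> 0^'+] --> c - 2 * k.
Proof.
move=> Hc; under [X in second_quotient X]eq_fun do rewrite -mulNr.
under eq_fun do rewrite second_quotientD second_quotientZ.
have -> : c - 2 * k = c + (- k) * 2 by ring.
apply: (cvgD Hc); apply: (@cvgMr _ _ (0^'+)); exact: second_quotient_sqnorm.
Qed.

Lemma norm_delta i : `|delta_mx 0 i : 'rV[R]_N| <= 1.
Proof.
by apply: norm_rV_le => // j; rewrite !mxE eqxx/=; case: eqP; rewrite ?normr1 ?normr0.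
Qed.

End lap.

Section cont_at.
Context {R : realType} {T : topologicalType}.
Implicit Types (f g : T -> R) (x : T).

Lemma cont_atD f g x : {for x, continuous f} -> {for x, continuous g} ->
  {for x, continuous (fun y => f y + g y)}.
Proof. by move=> cf cg; exact: (@cvgD _ _ _ (nbhs x) (nbhs_filter x) f g). Qed.

Lemma cont_atB f g x : {for x, continuous f} -> {for x, continuous g} ->
  {for x, continuous (fun y => f y - g y)}.
Proof. by move=> cf cg; exact: (@cvgB _ _ _ (nbhs x) (nbhs_filter x) f g). Qed.

Lemma cont_atZ f x k : {for x, continuous f} -> {for x, continuous (fun y => k * f y)}.
Proof. by move=> cf; exact: (@cvgMr _ _ (nbhs x) (nbhs_filter x) f k). Qed.

Lemma cont_atN f x : {for x, continuous f} -> {for x, continuous (fun y => - f y)}.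
Proof. by move=> cf; exact: (@cvgN _ _ _ (nbhs x) (nbhs_filter x) f). Qed.

End cont_at.

Lemma sqnorm_cont_at {R : realType} {N : nat} (x0 x : 'rV[R]_N) :
  {for x, continuous (fun y : 'rV[R]_N => sqnorm (y - x0))}.
Proof.
apply: (@continuous_comp _ _ _ (fun y : 'rV[R]_N => y - x0) sqnorm).
  by apply: continuousB; [exact: (@cvg_id _ (nbhs x))|exact: cst_continuous].
exact: sqnorm_cont.
Qed.

(** * Distributional inequalities in the viscosity sense *)

Section viscosity.
Context {R : realType} {N : nat}.
Implicit Types (x y : 'rV[R]_N).

(** [Delta u <= k] in the viscosity sense. The comparison function [zeta] has its
    Laplacian [g] near [x0] and [g] is continuous at [x0], because proofs move the point
    of contact a little. *)
Definition visc_laplacian_le (D : set 'rV[R]_N) (u k : 'rV[R]_N -> R) : Prop :=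
  forall x0 (zeta g : 'rV[R]_N -> R), D x0 ->
  (\forall x \near x0, laplacian_at zeta x (g x)) ->
  (\forall x \near x0, {for x, continuous zeta}) ->
  {for x0, continuous g} ->
  (\forall x \near x0, u x0 - zeta x0 <= u x - zeta x) ->
  g x0 <= k x0.

(** Otherwise [Delta zeta > v] near the contact point [x0]. Subtracting
    [delta |x - x0|^2] from [zeta] makes the contact strict without spoiling this, so
    that the mollification [U] of [u] is also touched from below, up to a constant, at
    some point [xs] close to [x0]. The second quotients of [zeta] are at most those of
    [U] at [xs], so [Delta zeta] is at most the Laplacian of [U], which is the integral
    of [u] against the Laplacian of the mollifier. By hypothesis this is the integral of
    [v] against the mollifier, a mean value of [v] near [xs]. *)
Theorem visc_of_distr (D : set 'rV[R]_N) (u v : 'rV[R]_N -> R) : open D ->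
  (forall x, D x -> {for x, continuous u}) ->
  (forall x, D x -> {for x, continuous v}) ->
  distr_laplacian_eq D u v -> visc_laplacian_le D u v.
Proof.
move=> oD cu cv Duv x0 zeta g Dx0 Lz cz cg umin.
rewrite leNgt; apply/negP => vg.
pose gap := g x0 - v x0.
have gap0 : 0 < gap by rewrite subr_gt0.
(* The perturbation lowers the Laplacian of [zeta] by [2 N delta <= gap / 2], so the
   level [c] below still separates it from [v]. *)
pose delta := gap / (4 * (N%:R + 1)).
have N1 : 0 < N%:R + 1 :> R by rewrite ltr_wpDl.
have delta0 : 0 < delta by rewrite divr_gt0// mulr_gt0.
have Ndelta : 2 * N%:R * delta <= gap / 2.
  rewrite /delta mulrA ler_pdivrMr ?mulr_gt0//.
  have : 0 <= gap * 2 by rewrite mulr_ge0// ltW.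
  set n := N%:R; move=> G; rewrite -subr_ge0.
  by rewrite (_ : _ - _ = gap * 2) //; field.
pose c := v x0 + gap / 4.
have v_c : \forall y \near x0, v y < c.
  apply: (@cvgr_lt _ _ _ _ v (v x0) (cv x0 Dx0)); rewrite /c ltrDl; lra.
have g_c : \forall y \near x0, c < g y - 2 * N%:R * delta.
  have : \forall y \near x0, c + 2 * N%:R * delta < g y.
    apply: (@cvgr_gt _ _ _ _ g (g x0) cg); rewrite /c; move: Ndelta gap0; rewrite /gap.
    set a := 2 * _ * _; lra.
  by apply: filterS => y; rewrite ltrBrDr.
have D_n : \forall y \near x0, D y by exact: open_nbhs_nbhs.
have [r r0 Hr] : exists2 r : R, 0 < r & forall y, `|y - x0| <= 2 * r ->
    [/\ D y, v y < c, c < g y - 2 * N%:R * delta & laplacian_at zeta y (g y)] /\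
    ({for y, continuous zeta} /\ u x0 - zeta x0 <= u y - zeta y).
  have : \forall y \near x0, [/\ D y, v y < c, c < g y - 2 * N%:R * delta &
    laplacian_at zeta y (g y)] /\
    ({for y, continuous zeta} /\ u x0 - zeta x0 <= u y - zeta y).
    near=> y; split; last by split; near: y.
    by split; near: y.
  move=> /nbhs_ballP[d /= d0 Hd]; exists (d / 3); first by rewrite divr_gt0.
  by move=> y yd; apply: Hd; rewrite -ball_normE/= distrC; lra.
have HD y : `|y - x0| <= 2 * r -> D y by move=> /Hr[[]].
have q0 : 0 <= 2 * r by lra.
have [b [bd bs bp b00]] := @bump_exists R.
(* On the sphere of radius [r] the perturbation gains [delta r^2 = 3 eta], more than the
   error [2 eta] that comes from mollifying at [x0] and at a point of the sphere. *)
pose eta := delta * r ^+ 2 / 3.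
have eta0 : 0 < eta by rewrite /eta !mulr_gt0 ?invr_gt0 ?exprn_gt0.
have [e [e0 er He]] : exists e : R, [/\ 0 < e, e <= r &
    forall x, `|x - x0| <= r -> forall y, `|y - x| <= e -> `|u y - u x| <= eta].
  have := @unif_cont_compact R N [set x | `|x - x0| <= r] u eta (@compact_norm_ball _ _ x0 r).
  move=> /(_ _ eta0) H.
  have {}H : \forall e \near 0^'+, forall x, `|x - x0| <= r -> forall y, `|y - x| <= e ->
    `|u y - u x| <= eta.
    apply: H => x /= xr; apply: cu; apply: HD; lra.
  near (0 : R)^'+ => e; exists e; split.
  - by near: e; exact: nbhs_right_gt.
  - by near: e; exact: nbhs_right_le.
  - by near: e.
have [m [m0 Hm]] := tensor_mass (derivs_continuous bd (k := 0)) bp b00 (bs 0%N) N e0.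
have au : bounded_measurable x0 (2 * r) u by exact: (bounded_measurable_cont q0 oD HD cu).
have av : bounded_measurable x0 (2 * r) v by exact: (bounded_measurable_cont q0 oD HD cv).
have at' mm x : bounded_measurable x0 (2 * r) (tensor (factor b e x) mm).
  apply: (@bounded_measurable_cont _ _ _ _ q0 setT) => //; first exact: openT.
  move=> y _; apply: tensor_continuous => j k; apply: derivs_continuous => k' t;
    exact: is_derive_factor.
have am x : bounded_measurable x0 (2 * r) (mollifier b e x) by exact: at'.
have am2 i x : bounded_measurable x0 (2 * r) (mollifier_dd b e i x) by exact: at'.
have supp mm x y : `|x - x0| <= r -> 2 * r < `|y - x0| -> tensor (factor b e x) mm y = 0.
  move=> xr yr; apply: tensor_factor_supp => //.
  have := ler_normD (y - x) (x - x0); rewrite subrKA; lra.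
pose I := cube_integral x0 (2 * r).
have F1 x : `|x - x0| <= r -> I (mollifier b e x) = m.
  move=> xr; apply: cube_integral_total.
  - by move=> y; exact: mollifier_ge0.
  - by move=> y; exact: supp.
  - by rewrite -(Hm x); apply: eq_integral => t _; rewrite mollifierE; congr EFin;
      apply: eq_bigr => j _; rewrite mxE.
pose U x := I (fun y => u y * mollifier b e x y).
have F3 x : `|x - x0| <= r -> `|U x - m * u x| <= eta * m.
  move=> xr; rewrite -{1}(F1 x xr).
  have -> : U x - I (mollifier b e x) * u x = I (fun y => (u y - u x) * mollifier b e x y).
    rewrite mulrC -mulNr -cube_integralZ// -cube_integralD//;
      [|exact: bounded_measurableM|exact:
      (bounded_measurableM (bounded_measurable_cst _ _ _))].
    by congr (cube_integral _ _ _); apply/funext => y; ring.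
  rewrite -(F1 x xr) -cube_integralZ//.
  have auc : bounded_measurable x0 (2 * r) (fun y => u y - u x) by exact:
    (bounded_measurableD au (bounded_measurable_cst _ _ _)).
  apply: cube_integral_abs => //;
    [exact: bounded_measurableM|exact: (bounded_measurableM (bounded_measurable_cst _ _ _))|].
  move=> y yr; rewrite normrM (ger0_norm (mollifier_ge0 _ _ _ _))//.
  have [yx|yx] := leP `|y - x| e; first by rewrite ler_wpM2r// ?He// mollifier_ge0.
  by rewrite /mollifier tensor_factor_supp ?mulr0// ltW.
have [L [L0 HL]] := mollifier_lipschitz (N := N) bd bs e0.
have F4 x : {for x, continuous U}.
  have [Bu [_ HBu]] : exists B : R, True /\ forall y, `|y - x0| <= 2 * r -> `|u y| <= B.
    by have [_ [B ?]] := au; exists B.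
  have Bu0 : 0 <= Bu by apply: le_trans (HBu x0 _) => //; rewrite subrr normr0.
  pose M := I (fun=> Bu * L).
  have UL x' : `|U x - U x'| <= `|x - x'| * M.
    have -> : U x - U x' = I (fun y => u y * (mollifier b e x y - mollifier b e x' y)).
      rewrite /U -[X in _ - X]mul1r -mulNr -cube_integralZ// -?cube_integralD//;
        do ?[exact: bounded_measurableM|exact:
        (bounded_measurableM (bounded_measurable_cst _ _ _) (bounded_measurableM _ _))].
      by congr (cube_integral _ _ _); apply/funext => y; ring.
    rewrite /M -cube_integralZ//; last exact: bounded_measurable_cst.
    apply: cube_integral_abs => //.
    - by apply: bounded_measurableM => //; apply: (bounded_measurableD (am x));
      under eq_fun do rewrite -mulN1r;
      exact: (bounded_measurableM (bounded_measurable_cst _ _ _)).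
    - exact: (bounded_measurableM (bounded_measurable_cst _ _ _)
      (bounded_measurable_cst _ _ _)).
    - move=> y yr; rewrite normrM mulrCA; apply: ler_pM => //; first exact: HBu.
      by rewrite mulrC.
  have M0 : 0 <= M.
    rewrite /M -(mul0r (I (fun=> 0))) -cube_integralZ//; last exact: bounded_measurable_cst.
    apply: cube_integral_le => //; [exact:
      (bounded_measurableM (bounded_measurable_cst _ _ _)
      (bounded_measurable_cst _ _ _))|exact: bounded_measurable_cst|].
    by move=> y _; rewrite mul0r mulr_ge0.
  suff : U x' @[x' --> x] --> U x by [].
  apply/(@cvgrPdist_le _ _ _ (nbhs x) (nbhs_filter x)) => w w0.
  have wM : 0 < w / (M + 1) by rewrite divr_gt0// ltr_wpDl.
  apply/nbhs_ballP; exists (w / (M + 1)) => //= x'; rewrite -ball_normE/= => /ltW xx'.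
  apply: (le_trans (UL x')); apply: (@le_trans _ _ (w / (M + 1) * (M + 1))).
    by apply: ler_pM => //; rewrite lerDl.
  by rewrite divfK// gt_eqF// ltr_wpDl.
pose zt y := zeta y - delta * sqnorm (y - x0).
pose G x := U x - m * zt x.
have cG : {within [set x | `|x - x0| <= r], continuous G}.
  apply: continuous_in_subspaceT => x /set_mem /= xr.
  have [|_ [czx _]] := Hr x; first by lra.
  apply: cont_atB; first exact: F4.
  apply: cont_atZ; apply: cont_atB => //.
  by apply: cont_atZ; exact: sqnorm_cont_at.
have K0 : [set x | `|x - x0| <= r] !=set0 by exists x0; rewrite /= subrr normr0 ltW.
have [xs /set_mem /= xsr xsmin] := EVT_min_rV K0 (@compact_norm_ball _ _ x0 r) cG.
have {}xsmin y : `|y - x0| <= r -> G xs <= G y by move=> yr; apply: xsmin; rewrite inE.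
have xsi : `|xs - x0| < r.
  rewrite lt_neqAle xsr andbT; apply/eqP => xse.
  have x0r : `|x0 - x0| <= r by rewrite subrr normr0 ltW.
  have := xsmin x0 x0r; apply/negP; rewrite -ltNge /G /zt.
  have := F3 _ x0r; have := F3 _ xsr; rewrite !ler_norml => /andP[A1 _] /andP[_ A2].
  have [|_ [_ A3]] := Hr xs; first lra.
  have A4 := norm_sqnorm (xs - x0); rewrite xse in A4.
  have -> : sqnorm (x0 - x0) = 0 by rewrite subrr /sqnorm big1// => j _; rewrite mxE expr0n.
  have A5 : m * (delta * r ^+ 2) <= m * (delta * sqnorm (xs - x0)).
    by rewrite ler_pM2l// ler_pM2l.
  have A6 : m * (u x0 - zeta x0) <= m * (u xs - zeta xs) by rewrite ler_pM2l.
  have A7 : 3 * (eta * m) = m * (delta * r ^+ 2) by rewrite /eta; field.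
  have A8 : 0 < eta * m by rewrite mulr_gt0.
  rewrite !mulrBr in A6 *. move: A5 A7 A8; rewrite [delta * 0]mulr0 [m * 0]mulr0;
    move: A1 A2 A6; set em := eta * m.
  set p1 := m * (delta * sqnorm _); set p2 := m * (delta * _); set p3 := m * u xs; set p4 :=
    m * zeta xs; set p5 := m * u x0; set p6 := m * zeta x0.
  clearbody em p1 p2 p3 p4 p5 p6; lra.
have [[_ _ gxs [ci Hci sci]] _] : _ := Hr xs ltac:(lra).
(* Second quotients are compared at the minimum [xs] of [U - m zt]; those of [U]
   converge to the integral of [u] against the second derivative of the mollifier, the
   error being of order [t]. *)
have F5 i : m * (ci i - 2 * delta) <= I (fun y => u y * mollifier_dd b e i xs y).
  have [K [Kge0 HK]] := mollifier_second_diff (N := N) bd bs e0 i.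
  have LU : second_quotient U i xs t @[t --> 0^'+] -->
    I (fun y => u y * mollifier_dd b e i xs y).
    have [Bu HBu] : exists B : R, forall y, `|y - x0| <= 2 * r -> `|u y| <= B.
      by have [_ [B ?]] := au; exists B.
    have Bu0 : 0 <= Bu by apply: le_trans (HBu x0 _) => //; rewrite subrr normr0.
    pose M := I (fun=> Bu * K).
    have M0 : 0 <= M.
      rewrite /M -(mul0r (I (fun=> 0))) -cube_integralZ//; last exact: bounded_measurable_cst.
      apply: cube_integral_le => //; [exact:
        (bounded_measurableM (bounded_measurable_cst _ _ _)
        (bounded_measurable_cst _ _ _))|exact: bounded_measurable_cst|].
      by move=> y _; rewrite mul0r mulr_ge0.
    apply/cvgrPdist_le => w w0; near=> t.
    have t0 : 0 < t by near: t; exact: nbhs_right_gt.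
    have tw : t <= w / (M + 1).
      by near: t; apply: nbhs_right_le; rewrite divr_gt0// ltr_wpDl.
    pose E y := mollifier b e (xs + t *: delta_mx 0 i) y + mollifier b e
      (xs - t *: delta_mx 0 i) y - 2 * mollifier b e xs y.
    have aE : bounded_measurable x0 (2 * r) E.
      by apply: bounded_measurableD; [exact: bounded_measurableD|under eq_fun do rewrite
        -mulNr; exact: (bounded_measurableM (bounded_measurable_cst _ _ _))].
    have UE : U (xs + t *: delta_mx 0 i) + U (xs - t *: delta_mx 0 i) - 2 * U xs =
      I (fun y => u y * E y).
      rewrite /U -mulNr -cube_integralZ//; last exact: bounded_measurableM.
      rewrite -!cube_integralD//; do ?[exact: bounded_measurableM | exact:
        (bounded_measurableM (bounded_measurable_cst _ _ _) (bounded_measurableM _ _)) |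
        exact: (bounded_measurableD (bounded_measurableM _ _) (bounded_measurableM _ _))].
      by congr (cube_integral _ _ _); apply/funext => y; rewrite /E; ring.
    have -> : second_quotient U i xs t = t ^- 2 * I (fun y => u y * E y) by rewrite
      /second_quotient UE mulrC.
    have -> : I (fun y => u y * mollifier_dd b e i xs y) = t ^- 2 * I
      (fun y => t ^+ 2 * (u y * mollifier_dd b e i xs y)).
      by rewrite /I cube_integralZ ?mulKf//;
        [rewrite expf_neq0// gt_eqF|exact: bounded_measurableM].
    rewrite -mulrBr normrM (gtr0_norm (_ : 0 < t ^- 2)) ?invr_gt0 ?exprn_gt0//.
    rewrite mulrC ler_pdivrMr ?exprn_gt0//.
    have -> : I (fun y => t ^+ 2 * (u y * mollifier_dd b e i xs y)) - I (fun y => u y * E y) =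
      I (fun y => - u y * (E y - t ^+ 2 * mollifier_dd b e i xs y)).
      rewrite /I -[X in _ - X]mul1r -mulNr -cube_integralZ//; last exact: bounded_measurableM.
      rewrite -cube_integralD//; do ?[exact:
        (bounded_measurableM (bounded_measurable_cst _ _ _) (bounded_measurableM _ _))].
      by congr (cube_integral _ _ _); apply/funext => y; ring.
    apply: (@le_trans _ _ (t ^+ 3 * M)).
      rewrite /M -cube_integralZ//; last exact: bounded_measurable_cst.
      apply: cube_integral_abs => //.
      - apply: bounded_measurableM; first by under eq_fun do rewrite -mulN1r;
        exact: (bounded_measurableM (bounded_measurable_cst _ _ _)).
        by apply: bounded_measurableD => //; under eq_fun do rewrite -mulNr;
          exact: (bounded_measurableM (bounded_measurable_cst _ _ _)).
      - exact: (bounded_measurableM (bounded_measurable_cst _ _ _)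
        (bounded_measurable_cst _ _ _)).
      - move=> y yr; rewrite normrM normrN mulrCA; apply: ler_pM => //; first exact: HBu.
        by rewrite [leRHS]mulrC; apply: HK; exact: ltW.
    rewrite exprS mulrAC; apply: ler_wpM2r; first by rewrite exprn_ge0// ltW.
    apply: (@le_trans _ _ (w / (M + 1) * (M + 1))).
      by apply: ler_pM; rewrite ?lerDl// ltW.
    by rewrite divfK// gt_eqF// ltr_wpDl.
  have LZ : m * second_quotient zt i xs t @[t --> 0^'+] --> m * (ci i - 2 * delta).
    apply: cvgMr.
    exact: second_quotient_subZsqnorm.
  apply: (ler_cvg_to LZ LU); near=> t.
  have t0 : 0 < t by near: t; exact: nbhs_right_gt.
  have tr : t <= r - `|xs - x0| by near: t; apply: nbhs_right_le; rewrite subr_gt0.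
  have nd (s : R) : `|s| <= t -> `|xs + s *: delta_mx 0 i - x0| <= r.
    move=> st; rewrite addrAC; apply: (le_trans (ler_normD _ _)).
    have : `|s *: (delta_mx 0 i : 'rV[R]_N)| <= t.
      by rewrite normrZ -[leRHS]mulr1; apply: ler_pM => //; exact: norm_delta.
    by move: tr; lra.
  have G1 : G xs <= G (xs + t *: delta_mx 0 i) by apply/xsmin/nd; rewrite gtr0_norm.
  have G2 : G xs <= G (xs - t *: delta_mx 0 i).
    by rewrite -scaleNr; apply/xsmin/nd; rewrite normrN gtr0_norm.
  rewrite /second_quotient mulrA ler_pM2r ?invr_gt0 ?exprn_gt0//.
  by move: G1 G2; rewrite /G !mulrBr !mulrDr; lra.
have S1 : m * (g xs - 2 * N%:R * delta) <= I (fun y => u y * laplacian (mollifier b e xs) y).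
  have [|_ E2] := @cube_integral_sum R N x0 (2 * r) q0 _ (index_enum 'I_N)
    (fun i y => u y * mollifier_dd b e i xs y).
    by move=> i; exact: bounded_measurableM.
  have -> : (fun y => u y * laplacian (mollifier b e xs) y) =
    (fun y => \sum_i u y * mollifier_dd b e i xs y).
    by apply/funext => y; rewrite laplacian_mollifier// mulr_sumr.
  rewrite /I E2.
  apply: (@le_trans _ _ (\sum_i m * (ci i - 2 * delta))); last by apply: ler_sum => i _;
    exact: F5.
  rewrite -mulr_sumr ler_pM2l// big_split/= sci sumr_const card_ord -mulr_natr le_eqVlt;
    apply/orP; left; apply/eqP; ring.
(* The mollifier centred at [xs] is a test function. *)
have S2 : I (fun y => u y * laplacian (mollifier b e xs) y) =
  I (fun y => v y * mollifier b e xs y).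
  rewrite /I -!(integral_rV_cube HD).
  - apply: Duv; apply: mollifier_test => // y ye; apply: HD.
    have := ler_normD (y - xs) (xs - x0); rewrite subrKA; lra.
  - by move=> y yr; rewrite /mollifier supp ?mulr0.
  - move=> y yr; rewrite laplacian_mollifier// big1 ?mulr0// => i _; exact: supp.
have S3 : I (fun y => v y * mollifier b e xs y) <= c * m.
  rewrite -(F1 xs xsr) /I -cube_integralZ//; apply: cube_integral_le => //.
  - exact: bounded_measurableM.
  - exact: (bounded_measurableM (bounded_measurable_cst _ _ _)).
  - by move=> y /Hr[[_ /ltW vc _ _] _]; rewrite ler_wpM2r// mollifier_ge0.
have : m * c < m * (g xs - 2 * N%:R * delta) by rewrite ltr_pM2l.
rewrite S2 in S1; move: S1 S3; rewrite [c * m]mulrC; lra.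
Unshelve. all: by end_near. Qed.

End viscosity.

(** * Harmonic functions and Gaussians *)

Section second_derivative.
Context {R : realType}.

(** The second derivative [l] is known at 0 only, so the mean value theorem is applied
    once, to [q s + q (- s) - s^2 l], whose derivative is [o(s)] by the definition of
    the derivative of [q1] at 0. *)
Lemma second_quotient_cvg (q q1 : R -> R) (d l : R) : 0 < d ->
  (forall t : R, `|t| < d -> is_derive t (1 : R) q (q1 t)) ->
  is_derive (0 : R) (1 : R) q1 l ->
  (q t + q (- t) - 2 * q 0) / t ^+ 2 @[t --> 0^'+] --> l.
Proof.
move=> d0 qd [q1d q1l].
have L : h^-1 *: ((q1 \o shift 0) (h *: (1 : R)) - q1 0) @[h --> 0^'] --> l.
  by rewrite -q1l; exact: q1d.
apply/cvgrPdist_le => e e0.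
have [d' d'0 Hd'] : exists2 d' : R, 0 < d' & forall s, `|s| < d' -> `|q1 s - q1 0 - l * s| <=
  e / 2 * `|s|.
  have e2 : 0 < e / 2 by rewrite divr_gt0.
  have /cvgrPdist_le/(_ _ e2)[d' /= d'0 Hd'] := L.
  exists d' => // s sd; have [->|s0] := eqVneq s 0.
    by rewrite subrr sub0r mulr0 normrN !normr0 mulr0.
  have := Hd' s; rewrite /ball_/= sub0r normrN => /(_ sd s0).
  rewrite addr0 [s *: 1]mulr1 => H.
  rewrite (_ : q1 s - q1 0 - l * s = - (l - s^-1 *: (q1 s - q1 0)) * s).
    by rewrite normrM normrN ler_wpM2r.
  by rewrite /GRing.scale/=; field.
near=> t.
have t0 : 0 < t by near: t; exact: nbhs_right_gt.
have td : t < d by near: t; exact: nbhs_right_lt.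
have td' : t < d' by near: t; exact: nbhs_right_lt.
pose p s := q s + q (- s) - s ^+ 2 * l.
have pd (s : R) : 0 <= s <= t -> is_derive s (1 : R) p (q1 s - q1 (- s) - 2 * s * l).
  move=> /andP[s0 st].
  have e1 := qd s ltac:(rewrite ger0_norm//; exact: le_lt_trans td).
  have e2 : is_derive s (1 : R) (fun s => q (- s)) (- q1 (- s)).
    have e3 : is_derive s (1 : R) (fun s : R => - s) (-1) by apply: is_derive_eq.
    have e4 := qd (- s) ltac:(rewrite normrN ger0_norm//; exact: le_lt_trans td).
    by have := @is_derive1_comp R q _ s _ _ e4 e3; rewrite mulrN1.
  by rewrite /p; apply: is_derive_eq; rewrite /GRing.scale/=; ring.
have pb (s : R) : 0 <= s <= t -> `|q1 s - q1 (- s) - 2 * s * l| <= e * t.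
  move=> /andP[s0 st].
  have H1 := Hd' s ltac:(rewrite ger0_norm//; exact: le_lt_trans td').
  have H2 := Hd' (- s) ltac:(rewrite normrN ger0_norm//; exact: le_lt_trans td').
  rewrite normrN in H2.
  rewrite (_ : _ - _ = (q1 s - q1 0 - l * s) - (q1 (- s) - q1 0 - l * - s)); last ring.
  apply: (le_trans (ler_normB _ _)); apply: (le_trans (lerD H1 H2)).
  by rewrite (ger0_norm s0) -mulrDl -splitr ler_wpM2l// ltW.
have := mvt_bound (ltW t0) pd pb.
rewrite /p oppr0 expr0n/= mul0r subr0 => H.
rewrite -[l](@mulfK _ (t ^+ 2)) ?expf_neq0 ?gt_eqF// -mulrBl normrM normfV.
rewrite (gtr0_norm (_ : 0 < t ^+ 2)) ?exprn_gt0// ler_pdivrMr ?exprn_gt0//.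
rewrite distrC expr2 [e * _]mulrA (le_trans _ H)//.
rewrite le_eqVlt; apply/orP; left; apply/eqP; congr (`|_|); ring.
Unshelve. all: by end_near. Qed.

End second_derivative.

Section laplacian_tools.
Context {R : realType} {N : nat}.
Implicit Types (x y : 'rV[R]_N) (f h : 'rV[R]_N -> R).

Lemma line_derive f i x s : derivable f (x + s *: delta_mx 0 i) (delta_mx 0 i) ->
  is_derive s (1 : R) (fun t => f (x + t *: delta_mx 0 i))
    (partial i f (x + s *: delta_mx 0 i)).
Proof.
move=> df.
have E : (fun h : R => h^-1 *: (((fun t => f (x + t *: delta_mx 0 i)) \o shift s)
  (h *: (1 : R)) - f (x + s *: delta_mx 0 i)))
    = (fun h : R => h^-1 *: ((f \o shift (x + s *: delta_mx 0 i)) (h *: delta_mx 0 i) - f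
      (x + s *: delta_mx 0 i))).
  apply/funext => h /=; congr (_ *: (f _ - _)).
  by rewrite [h *: 1]mulr1 scalerDl addrCA.
apply: DeriveDef; first by rewrite /derivable E; exact: df.
by rewrite /derive E.
Qed.

Lemma laplacian_at_C2 (D : set 'rV[R]_N) h x : open D -> Ck 2 D h -> D x ->
  laplacian_at h x (laplacian h x).
Proof.
move=> oD [_ C2] Dx; exists (fun i => partial i (partial i h) x) => // i.
have [dh [_ /(_ i)[dph _]]] := C2 i.
have [d d0 Hd] : exists2 d : R, 0 < d & forall t, `|t| < d -> D (x + t *: delta_mx 0 i).
  have /nbhs_ballP[d /= d0 Hd] : nbhs x D by exact: open_nbhs_nbhs.
  exists d => // t td; apply: Hd; rewrite -ball_normE/= opprD addrA subrr sub0r normrN.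
  rewrite normrZ (le_lt_trans _ td)// -[leRHS]mulr1 ler_wpM2l//; exact: norm_delta.
have H := @second_quotient_cvg R (fun t => h (x + t *: delta_mx 0 i))
  (fun t => partial i h (x + t *: delta_mx 0 i)) d
  (partial i (partial i h) x) d0.
rewrite /second_quotient; under eq_fun do rewrite -scaleNr -{3}[x]addr0
  -(scale0r (delta_mx 0 i)).
apply: H.
- by move=> t td; apply: line_derive; apply: dh; exact: Hd.
- have := @line_derive (partial i h) i x 0; rewrite scale0r addr0; apply; exact: dph.
Qed.

Definition gauss (lam : R) y x : R := expR (- lam * sqnorm (x - y)).
(** Positive where [|x - y|^2 > N / (2 lam)]: away from its centre a Gaussian is
    strictly subharmonic, which makes it a barrier on rings. *)
Definition laplacian_gauss (lam : R) y x : R :=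
  (4 * lam ^+ 2 * sqnorm (x - y) - 2 * N%:R * lam) * gauss lam y x.

Lemma laplacian_at_gauss lam y x : laplacian_at (gauss lam y) x (laplacian_gauss lam y x).
Proof.
exists (fun i => (4 * lam ^+ 2 * (x - y) 0 i ^+ 2 - 2 * lam) * gauss lam y x); last first.
  rewrite -mulr_suml big_split/= -mulr_sumr sumr_const card_ord -mulr_natr /laplacian_gauss
    /sqnorm.
  congr (_ * _); ring.
move=> i.
pose P (t : R) := sqnorm (x - y) + 2 * t * (x - y) 0 i + t ^+ 2.
have Pd (t : R) : is_derive t (1 : R) P (2 * (x - y) 0 i + 2 * t).
  by rewrite /P; apply: is_derive_eq; rewrite /GRing.scale/=; ring.
have qd (t : R) : is_derive t (1 : R) (fun t => expR (- lam * P t))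
    ((- lam * (2 * (x - y) 0 i + 2 * t)) * expR (- lam * P t)).
  by apply: is_derive_eq; rewrite /GRing.scale/=; ring.
have q1d : is_derive (0 : R) (1 : R)
  (fun t => (- lam * (2 * (x - y) 0 i + 2 * t)) * expR (- lam * P t))
    ((4 * lam ^+ 2 * (x - y) 0 i ^+ 2 - 2 * lam) * gauss lam y x).
  have e1 := qd 0.
  apply: is_derive_eq; rewrite /GRing.scale/= /gauss /P expr0n/= !(mulr0, mul0r, addr0).
  ring.
have := @second_quotient_cvg R (fun t => expR (- lam * P t)) _ 1 _ ltr01 (fun t _ => qd t)
  q1d.
suff -> : (fun t : R => second_quotient (gauss lam y) i x t) =
  (fun t : R => (expR (- lam * P t) + expR (- lam * P (- t)) - 2 * expR (- lam * P 0)) / t ^+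
  2) by [].
apply/funext => t; rewrite /second_quotient /gauss -scaleNr !(addrAC x _ (- y)) !sqnorm_delta
  /P.
by rewrite expr0n/= mulr0 mul0r !addr0.
Qed.

Lemma gauss_cont lam y x : {for x, continuous (gauss lam y)}.
Proof.
apply: (@continuous_comp _ _ _ (fun x : 'rV[R]_N => - lam * sqnorm (x - y)) expR).
  by apply: cont_atZ; exact: sqnorm_cont_at.
exact: continuous_expR.
Qed.

Lemma laplacian_gauss_cont lam y x : {for x, continuous (laplacian_gauss lam y)}.
Proof.
apply: (@continuousM _ _ _ _ _); last exact: gauss_cont.
apply: cont_atB; last exact: cst_continuous.
by apply: cont_atZ; exact: sqnorm_cont_at.
Qed.

Lemma laplacian_at_min f x l : laplacian_at f x l -> (\forall y \near x, f x <= f y) -> 0 <=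
  l.
Proof.
move=> [c Hc <-] fm; apply: sumr_ge0 => i _.
apply: (cvgr_to_ge (Hc i)).
move: fm => /nbhs_ballP[d /= d0 Hd].
near=> t.
have t0 : 0 < t by near: t; exact: nbhs_right_gt.
have td : t < d by near: t; exact: nbhs_right_lt.
have H (s : R) : `|s| <= t -> f x <= f (x + s *: delta_mx 0 i).
  move=> st; apply: Hd; rewrite -ball_normE/= opprD addrA subrr sub0r normrN.
  rewrite normrZ (le_lt_trans _ td)// (le_trans _ st)// -[leRHS]mulr1 ler_wpM2l//;
    exact: norm_delta.
rewrite /second_quotient; apply: divr_ge0; last by rewrite exprn_ge0// ltW.
have := H t; have := H (- t); rewrite normrN gtr0_norm// scaleNr =>
  /(_ (lexx _)) H1 /(_ (lexx _)) H2.
by rewrite subr_ge0; lra.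
Unshelve. all: by end_near. Qed.

Lemma harmonic_laplacian_at (D : set 'rV[R]_N) h : open D -> harmonic_in D h ->
  forall x, D x -> laplacian_at h x 0.
Proof. by move=> oD [C2 lap0] x Dx; have := laplacian_at_C2 oD C2 Dx; rewrite lap0. Qed.

(** [h - zeta] has a minimum at the point of contact, and second quotients at a minimum
    are nonnegative. *)
Lemma visc_of_harmonic (D : set 'rV[R]_N) h : (forall x, D x -> laplacian_at h x 0) ->
  visc_laplacian_le D h (fun=> 0).
Proof.
move=> Lh x0 zeta g Dx0 Lz _ _ hm.
have := laplacian_atD (Lh _ Dx0) (laplacian_atZ (-1) (nbhs_singleton Lz)).
rewrite add0r mulN1r => /laplacian_at_min; rewrite oppr_ge0; apply.
by apply: filterS hm => y; rewrite !mulN1r.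
Qed.

(** As [u] and [v] are arbitrary, the integrands may fail to be integrable and the
    integral to be linear; its oddness comes from exchanging positive and negative
    parts. *)
Lemma distr_laplacian_opp (D : set 'rV[R]_N) u v : distr_laplacian_eq D u v ->
  distr_laplacian_eq D (fun x => - u x) (fun x => - v x).
Proof.
move=> H psi tp.
have RN (f : 'rV[R]_N -> R) : integral_rV D (fun x => - f x) = - integral_rV D f.
  rewrite /integral_rV /Rintegral integralE [in RHS]integralE.
  set F := (fun t => (f _)%:E); rewrite (_ : (fun t => (- f _)%:E) = (\- F)%E)//.
  rewrite funeposN funenegN.
  set a := integral _ _ _; set b := integral _ _ _.
  have a0 : (0 <= a)%E by apply: integral_ge0 => *; exact: funeneg_ge0.
  have b0 : (0 <= b)%E by apply: integral_ge0 => *; exact: funepos_ge0.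
  (* If one of the parts has infinite integral, both sides are [fine] of an infinite
     value, that is 0. *)
  by case: a a0 => [a| |]//; case: b b0 => [b| |]// _ _ /=; rewrite ?oppr0// opprB.
under eq_fun do rewrite mulNr; rewrite RN.
under [in RHS]eq_fun do rewrite mulNr; rewrite RN.
by rewrite H.
Qed.

Lemma within_closure_interior (D : set 'rV[R]_N) (u : 'rV[R]_N -> R) : open D ->
  {within closure D, continuous u} -> forall x, D x -> {for x, continuous u}.
Proof.
move=> oD cu x Dx.
have cuD : {within D, continuous u} by apply: continuous_subspaceW cu; exact: subset_closure.
by move: cuD; rewrite continuous_open_subspace// => /(_ x); apply; rewrite inE.
Qed.

Lemma closure_boundary (D : set 'rV[R]_N) x : open D -> closure D x -> D x \/ boundary D x.
Proof.
move=> oD cx; have [Dx|nDx] := pselect (D x); first by left.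
by right; split => //; exact: subset_closure.
Qed.

Lemma compact_closure_bounded (D : set 'rV[R]_N) : bounded_set D -> compact (closure D).
Proof.
move=> bD; apply: bounded_closed_compact; last exact: closed_closure.
have [M [_ HM]] := bD.
have DM : D `<=` [set x | `|x - 0| <= M + 1].
  by move=> x Dx /=; rewrite subr0; apply: HM => //; rewrite ltrDl.
have cDM : closure D `<=` [set x | `|x - 0| <= M + 1].
  by rewrite [X in _ `<=` X](closure_id _).1; [exact: closure_subset|exact: closed_norm_ball].
exists (M + 1); split; rewrite ?num_real// => A MA x /cDM /=; rewrite subr0 => /le_trans;
  apply; exact: ltW.
Qed.

End laplacian_tools.

(** * Comparison principles and barriers *)

Section within_cont.
Context {R : realType} {T : topologicalType} (A : set T).
Implicit Types (f g : T -> R).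

Lemma within_contD f g : {within A, continuous f} -> {within A, continuous g} ->
  {within A, continuous (fun y => f y + g y)}.
Proof. by move=> cf cg x; exact: (@cont_atD R (subspace A) f g x (cf x) (cg x)). Qed.

Lemma within_contB f g : {within A, continuous f} -> {within A, continuous g} ->
  {within A, continuous (fun y => f y - g y)}.
Proof. by move=> cf cg x; exact: (@cont_atB R (subspace A) f g x (cf x) (cg x)). Qed.

Lemma within_contZ f k : {within A, continuous f} ->
  {within A, continuous (fun y => k * f y)}.
Proof. by move=> cf x; exact: (@cont_atZ R (subspace A) f x k (cf x)). Qed.

End within_cont.

Section comparison.
Context {R : realType} {N : nat}.
Implicit Types (D : set 'rV[R]_N) (x y z : 'rV[R]_N) (u v h k : 'rV[R]_N -> R).

Lemma sqnorm_le_norm x : sqnorm x <= N%:R * `|x| ^+ 2.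
Proof.
rewrite /sqnorm; apply: (@le_trans _ _ (\sum_(j < N) `|x| ^+ 2)).
  apply: ler_sum => j _; rewrite -[leLHS]real_normK ?num_real// lerXn2r// ?nnegrE//.
  exact: coord_le_norm.
by rewrite sumr_const card_ord mulr_natl.
Qed.

Lemma sqnorm0 : sqnorm (0 : 'rV[R]_N) = 0.
Proof. by rewrite /sqnorm big1// => j _; rewrite mxE expr0n. Qed.

Lemma norm_le_sqnorm x (r : R) : 0 <= r -> sqnorm x <= r ^+ 2 -> `|x| <= r.
Proof.
move=> r0 xr; rewrite -(@ler_pXn2r _ 2%N)// ?nnegrE//.
exact: le_trans (norm_sqnorm x) xr.
Qed.

Lemma closed_sqnorm y b : closed [set x | sqnorm (x - y) <= b].
Proof.
have -> : [set x | sqnorm (x - y) <= b] = (fun x => sqnorm (x - y)) @^-1` [set t | t <= b] by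
  [].
apply: closed_comp; last exact: closed_le.
by move=> x _; exact: sqnorm_cont_at.
Qed.

Lemma compact_sqnorm y b : compact [set x | sqnorm (x - y) <= b].
Proof.
apply: (subclosed_compact _ (@compact_norm_ball _ _ y (Num.max 1 b)));
  first exact: closed_sqnorm.
move=> x /= xb; apply: norm_le_sqnorm; first by rewrite le_max ler01.
rewrite (le_trans xb)// (@le_trans _ _ (Num.max 1 b))//; first by rewrite le_max lexx orbT.
by rewrite expr2 ler_peMr// le_max ?lexx// ler01.
Qed.

Lemma near_sqnorm_lt y b x : sqnorm (x - y) < b -> \forall z \near x, sqnorm (z - y) < b.
Proof.
by move=> H; apply: (@cvgr_lt _ _ _ _ (fun z => sqnorm (z - y)) (sqnorm (x - y))
  (@sqnorm_cont_at _ _ y x)).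
Qed.

(** If [u > h] somewhere, then [u - h + delta |x|^2] has its maximum inside [D] for
    small [delta]. There [- u] is touched from below by [- h + delta |x|^2], whose
    Laplacian [2 N delta] is positive, against [Delta u >= 0]. *)
Lemma upper_comparison D u h v : (0 < N)%N -> open D -> bounded_set D ->
  {within closure D, continuous u} -> {within closure D, continuous h} ->
  visc_laplacian_le D (fun x => - u x) (fun x => - v x) -> (forall x, D x -> 0 <= v x) ->
  (forall x, D x -> laplacian_at h x 0) -> (forall x, boundary D x -> u x <= h x) ->
  forall x, closure D x -> u x <= h x.
Proof.
move=> N0 oD bD cu ch su v0 lap0 uh x1 cx1.
rewrite leNgt; apply/negP => hu.
have cD := compact_closure_bounded bD.
have D0 : closure D !=set0 by exists x1.
have cs : continuous (fun x => sqnorm (x - 0)) by move=> x; exact: sqnorm_cont_at.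
have [s /set_mem _ Hs] := EVT_max_rV D0 cD (continuous_subspaceT cs).
pose S := sqnorm (s - 0).
have S0 : 0 <= S by exact: sqnorm_ge0.
pose delta := (u x1 - h x1) / (2 * (S + 1)).
have uh0 : 0 < u x1 - h x1 by rewrite subr_gt0.
have S1 : 0 < S + 1 by rewrite ltr_wpDl.
have d0 : 0 < delta by rewrite divr_gt0// mulr_gt0.
have dS : delta * S < u x1 - h x1.
  rewrite /delta mulrAC ltr_pdivrMr ?mulr_gt0// ltr_pM2l//; lra.
have cv : {within closure D, continuous (fun x => (u x - h x) + delta * sqnorm (x - 0))}.
  apply: within_contD; first exact: within_contB.
  by apply: within_contZ; exact: (continuous_subspaceT cs).
have [xs /set_mem cxs Hxs] := EVT_max_rV D0 cD cv.
have H1 := Hxs x1 (mem_set cx1).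
have H2 : delta * sqnorm (xs - 0) <= delta * S by rewrite ler_pM2l// Hs// inE.
have H3 : 0 <= delta * sqnorm (x1 - 0) by rewrite mulr_ge0 ?sqnorm_ge0// ltW.
have Dxs : D xs.
  have [//|/uh bxs] := closure_boundary oD cxs.
  by exfalso; move: H1 H2 H3 dS bxs; lra.
pose zeta x := -1 * h x + delta * sqnorm (x - 0).
have Dn : \forall x \near xs, D x by exact: open_nbhs_nbhs.
have chD := within_closure_interior oD ch.
have : 2 * N%:R * delta <= - v xs.
  apply: (su xs zeta (fun=> 2 * N%:R * delta) Dxs).
  - apply: filterS Dn => x Dx; rewrite mulrC -[_ * _]add0r -[X in X + _](mulr0 (-1)).
    apply: laplacian_atD; last by apply: laplacian_atZ; exact: laplacian_at_sqnorm.
    by apply: laplacian_atZ; exact: lap0.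
  - apply: filterS Dn => x Dx; apply: cont_atD; last by apply: cont_atZ;
    exact: sqnorm_cont_at.
    by apply: cont_atZ; exact: chD.
  - exact: cst_continuous.
  - apply: filterS Dn => x Dx; have := Hxs x (mem_set (subset_closure Dx)).
    by rewrite /zeta; lra.
have : 0 < 2 * N%:R * delta by apply: mulr_gt0 => //; apply: mulr_gt0 => //; rewrite ltr0n.
have := v0 xs Dxs; lra.
Qed.

(** A substitute for the Harnack inequality. The left-hand side is a barrier on the ring
    [a < |x - y|^2 < b]: it is less than [m] on the inner ball, 0 on the outer sphere,
    and a strict subsolution of [Delta w = K w] in between, so it cannot exceed [v]
    anywhere. *)
Lemma ball_growth D v k (K m lam a b : R) y : visc_laplacian_le D v k -> 0 <= K -> 0 < m ->
  0 < lam ->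
  (forall x, D x -> {for x, continuous v}) -> (forall x, D x -> 0 <= v x) ->
  (forall x, D x -> k x <= K * v x) ->
  K < lam * (4 * lam * a - 2 * N%:R) ->
  (forall x, sqnorm (x - y) <= b -> D x) ->
  (forall x, sqnorm (x - y) <= a -> m <= v x) ->
  forall x, sqnorm (x - y) <= b -> m * (gauss lam y x - expR (- lam * b)) <= v x.
Proof.
move=> sv K0 m0 l0 cv v0 kK Klam bD va x1 x1b.
rewrite leNgt; apply/negP => x1v.
pose beta x := m * gauss lam y x + - (m * expR (- lam * b)).
have betaE x : beta x = m * (gauss lam y x - expR (- lam * b)) by rewrite mulrBr.
have cb x : {for x, continuous beta}.
  by apply: cont_atD; [apply: cont_atZ; exact: gauss_cont|exact: cst_continuous].
have c1 : {within [set x | sqnorm (x - y) <= b], continuous (fun x => v x - beta x)}.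
  apply: continuous_in_subspaceT => x /set_mem /= /bD Dx.
  by apply: cont_atB; [exact: cv|exact: cb].
have [xs /set_mem /= xsb Hxs] := EVT_min_rV (ex_intro _ x1 x1b) (@compact_sqnorm y b) c1.
have xsv : v xs < beta xs.
  have := Hxs x1 (mem_set x1b); rewrite betaE in x1v *; move: x1v; rewrite -betaE.
  by rewrite betaE; lra.
have Dxs := bD _ xsb.
have g0 x : 0 < gauss lam y x by exact: expR_gt0.
have xsb' : sqnorm (xs - y) < b.
  rewrite lt_neqAle xsb andbT; apply/eqP => E.
  have := v0 _ Dxs; move: xsv; rewrite betaE /gauss E subrr mulr0; lra.
have g1 : gauss lam y xs <= 1.
  by rewrite /gauss -expR0 ler_expR mulNr oppr_le0 mulr_ge0 ?sqnorm_ge0// ltW.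
have xsa : a < sqnorm (xs - y).
  rewrite ltNge; apply/negP => /va mv.
  have : m * gauss lam y xs <= m * 1 by rewrite ler_pM2l.
  have : 0 < m * expR (- lam * b) by rewrite mulr_gt0// expR_gt0.
  move: xsv; rewrite /beta; lra.
have near_b : \forall x \near xs, sqnorm (x - y) < b by exact: near_sqnorm_lt.
have : m * laplacian_gauss lam y xs <= k xs.
  apply: (sv xs beta (fun x => m * laplacian_gauss lam y x) Dxs).
  - apply: filterE => x; rewrite -[m * laplacian_gauss _ _ _]addr0; apply: laplacian_atD;
    last exact: laplacian_at_cst.
    by apply: laplacian_atZ; exact: laplacian_at_gauss.
  - by apply: filterE => x; exact: cb.
  - by apply: cont_atZ; exact: laplacian_gauss_cont.
  - by apply: filterS near_b => x xb; apply: Hxs; rewrite inE /= ltW.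
apply/negP; rewrite -ltNge (le_lt_trans (kK _ Dxs))//.
apply: (@le_lt_trans _ _ (K * (m * gauss lam y xs))).
  rewrite ler_wpM2l// (le_trans (ltW xsv))// /beta gerDl oppr_le0 mulr_ge0 ?expR_ge0// ltW//.
rewrite /laplacian_gauss [ltRHS]mulrCA ltr_pM2r ?mulr_gt0//.
apply: (lt_le_trans Klam).
have : lam * (lam * a) <= lam * (lam * sqnorm (xs - y)) by rewrite !ler_pM2l// ltW.
rewrite -subr_ge0 => H; rewrite -subr_ge0.
rewrite (_ : _ - _ = 4 * (lam * (lam * sqnorm (xs - y)) - lam * (lam * a))); last ring.
by rewrite mulr_ge0.
Qed.

(** The strong minimum principle: the set [v > 0] is closed in [D], since [ball_growth]
    around one of its points [y] close to [x] gives positivity on a ball that contains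
    [x]. *)
Lemma positivity D v k (K : R) : open D -> connected D -> visc_laplacian_le D v k -> 0 <= K ->
  (forall x, D x -> {for x, continuous v}) -> (forall x, D x -> 0 <= v x) ->
  (forall x, D x -> k x <= K * v x) ->
  (exists2 z, D z & 0 < v z) -> forall x, D x -> 0 < v x.
Proof.
move=> oD cD sv K0 cv v0 kK [z Dz vz].
pose B := [set x | D x /\ 0 < v x].
have oB : open B.
  rewrite openE => x [Dx vx]; rewrite /interior.
  have Dn : \forall y \near x, D y by exact: open_nbhs_nbhs.
  have vn : \forall y \near x, 0 < v y by apply: (@cvgr_gt _ _ _ _ v (v x) (cv x Dx)).
  by near=> y; split; near: y.
suff -> : D = B by move=> x [].
apply/esym/cD; first by exists z; split.
  by exists B => //; apply/seteqP; split=> x; [case=> ? ?; split|case].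
exists (closure B); first exact: closed_closure.
apply/seteqP; split=> x; first by move=> [Dx vx]; split=> //; apply: subset_closure.
move=> [Dx cBx]; split=> //.
have /nbhs_ballP[d /= d0 Hd] : nbhs x D by exact: open_nbhs_nbhs.
(* If [|x - y| < eta] in the sup norm, then [x] is in the Euclidean ball of radius
   [d / 2] around [y], and that ball is contained in [D]. *)
pose eta := d / (2 * (N%:R + 1)).
have N1 : 0 < N%:R + 1 :> R by rewrite ltr_wpDl.
have eta0 : 0 < eta by rewrite divr_gt0// mulr_gt0.
have eta2 : eta <= d / 2.
  by rewrite /eta ler_pM2l// lef_pV2 ?posrE ?mulr_gt0// ler_peMr// lerDr.
have [y [[Dy vy]]] := cBx _ (nbhsx_ballx x eta eta0).
rewrite -ball_normE/= => xy.
pose b := (d / 2) ^+ 2.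
have d2 : 0 <= d / 2 by rewrite divr_ge0// ltW.
have bD w : sqnorm (w - y) <= b -> D w.
  move=> wb; apply: Hd; rewrite -ball_normE/=.
  have wy : `|w - y| <= d / 2 by exact: norm_le_sqnorm.
  have := ler_normD (x - y) (y - w); rewrite subrKA [`|y - w|]distrC; lra.
have sxy : sqnorm (x - y) < b.
  apply: (le_lt_trans (sqnorm_le_norm _)).
  apply: (@le_lt_trans _ _ (N%:R * eta ^+ 2)).
    by rewrite ler_wpM2l// lerXn2r ?nnegrE// ltW.
  have H : (N%:R + 1) * eta = d / 2 by rewrite /eta; field; rewrite gt_eqF.
  apply: (@lt_le_trans _ _ ((N%:R + 1) * eta ^+ 2)); first by rewrite ltr_pM2r ?exprn_gt0//
    ltrDl.
  by rewrite expr2 mulrA H /b expr2 ler_wpM2l.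
have [d' d'0 Hd'] : exists2 d' : R, 0 < d' & forall w, `|w - y| <= d' -> v y / 2 <= v w.
  have : \forall w \near y, v y / 2 < v w.
    by apply: (@cvgr_gt _ _ _ _ v (v y) (cv y Dy)); rewrite ltr_pdivrMr// mulr_natr mulr2n
      ltrDl.
  move=> /nbhs_ballP[d' /= d'0 Hd']; exists (d' / 2); first by rewrite divr_gt0.
  move=> w wy; apply/ltW/Hd'; rewrite -ball_normE/= distrC (le_lt_trans wy)//.
  by rewrite ltr_pdivrMr// ltr_pMr// ltr1n.
pose a := d' ^+ 2.
have a0 : 0 < a by rewrite exprn_gt0.
(* Chosen so that [lam >= 1] and [4 lam a - 2 N > K]. *)
pose lam := (2 * N%:R + K + 1) / (4 * a) + 1.
have NK0 : 0 <= 2 * N%:R + K :> R by rewrite addr_ge0// mulr_ge0.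
have lam1 : 1 <= lam by rewrite /lam lerDr; apply: divr_ge0;
  [rewrite addr_ge0|rewrite mulr_ge0// ltW].
have lam0 : 0 < lam by rewrite (lt_le_trans ltr01).
have Klam : K < lam * (4 * lam * a - 2 * N%:R).
  have E : 4 * lam * a - 2 * N%:R = K + 1 + 4 * a by rewrite /lam; field; rewrite gt_eqF.
  rewrite E; apply: (@lt_le_trans _ _ (1 * (K + 1 + 4 * a)));
    first by rewrite mul1r -addrA ltrDl ltr_wpDl// mulr_gt0.
  by rewrite ler_wpM2r// !addr_ge0// mulr_ge0// ltW.
have m0 : 0 < v y / 2 by rewrite divr_gt0.
have := ball_growth sv K0 m0 lam0 cv v0 kK Klam bD _ (ltW sxy).
move=> /(_ (fun w wa => Hd' w (norm_le_sqnorm (ltW d'0) wa))); apply: lt_le_trans.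
by rewrite mulr_gt0// subr_gt0 /gauss ltr_expR ltr_nM2l// oppr_lt0.
Unshelve. all: by end_near. Qed.

(** Let [m > 0] be the maximum of [c h - u], attained at [x0]. Then [x0] is in the layer
    [h < lam], and so close to a ball of centre [y] and radius [r] outside [D]. The
    barrier [m (1 + exp (- l L^2 r^2) - exp (- l |x - y|^2))] is positive, less than [m]
    at [x0], and equal to [m] at distance [L r] from [y]. Hence [c h - u] minus the
    barrier has a positive interior maximum [xs] among the points at distance at most
    [L r]. There [c h - u] is positive, so [xs] is in the layer too and
    [Delta u <= K c lam], whereas the barrier has Laplacian at most
    [- m l exp (- l L^2 r^2)]. Comparing the two bounds [m]. *)
Lemma thin_layer D u h k (K c lam rho L : R) : open D -> bounded_set D ->
  {within closure D, continuous u} -> {within closure D, continuous h} ->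
  visc_laplacian_le D u k -> 0 <= K -> (forall x, D x -> k x <= K * u x) ->
  (forall x, D x -> laplacian_at h x 0) ->
  0 < c -> 0 <= lam -> 0 < L ->
  (forall x, boundary D x -> c * h x <= u x) ->
  (forall x, D x -> lam <= h x -> c * h x <= u x) ->
  (forall x, D x -> h x < lam -> exists y r, [/\ 0 < r, r <= rho,
      (forall z, D z -> r ^+ 2 <= sqnorm (z - y)) & sqnorm (x - y) < (L * r) ^+ 2]) ->
  forall x, closure D x ->
    c * h x - u x <= K * (c * lam) * (rho ^+ 2 * expR ((N%:R + 1) * L ^+ 2)).
Proof.
move=> oD bD cu ch su K0 kK lap0 c0 lam0 L0 ub ul ext x1 cx1.
set M := _ * (_ * expR _).
have cD := compact_closure_bounded bD.
have cv : {within closure D, continuous (fun x => c * h x - u x)}.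
  by apply: within_contB => //; exact: within_contZ.
have [x0 /set_mem cx0 Hx0] := EVT_max_rV (ex_intro _ x1 cx1) cD cv.
apply: (le_trans (Hx0 x1 (mem_set cx1))).
have {}Hx0 x : closure D x -> c * h x - u x <= c * h x0 - u x0 by move=> ?; apply: Hx0;
  rewrite inE.
set m := c * h x0 - u x0 in Hx0 *.
have M0 : 0 <= M by rewrite /M; apply: mulr_ge0; apply: mulr_ge0 => //;
  [apply: mulr_ge0 => //; exact: ltW|exact: sqr_ge0].
rewrite leNgt; apply/negP => Mm.
have m0 : 0 < m by exact: le_lt_trans M0 Mm.
have inD x : closure D x -> 0 < c * h x - u x -> D x /\ h x < lam.
  move=> cx; rewrite subr_gt0 => ux.
  have [Dx|/ub] := closure_boundary oD cx; last by rewrite leNgt ux.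
  by split=> //; rewrite ltNge; apply/negP => /(ul _ Dx); rewrite leNgt ux.
have [Dx0 hx0] := inD _ cx0 m0.
have [y [r [r0 rrho extr x0y]]] := ext _ Dx0 hx0.
pose n1 : R := N%:R + 1.
have n10 : 0 < n1 by rewrite /n1 ltr_wpDl.
(* With this [l] one has [4 l^2 s - 2 N l >= l] as soon as [s >= r^2], in particular on
   [D] for [s = |x - y|^2], and [l L^2 r^2] does not depend on [r]. *)
pose l := n1 / r ^+ 2.
have l0 : 0 < l by rewrite divr_gt0// exprn_gt0.
pose b := (L * r) ^+ 2.
have lb : l * b = n1 * L ^+ 2 by rewrite /l /b exprMn; field; rewrite gt_eqF.
pose eb := expR (- l * b).
have eb0 : 0 < eb by exact: expR_gt0.
pose beta x := m * (1 + eb) + (- m) * gauss l y x.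
have cb x : {for x, continuous beta}.
  by apply: cont_atD; [exact: cst_continuous|apply: cont_atZ; exact: gauss_cont].
pose Q := closure D `&` [set x | sqnorm (x - y) <= b].
have cQ : compact Q.
  by rewrite /Q setIC; apply: compact_closedI; [exact: compact_sqnorm|exact: closed_closure].
have x0Q : Q x0 by split=> //; exact: ltW.
have cvb : {within Q, continuous (fun x => (c * h x - u x) - beta x)}.
  apply: within_contB; last by apply: continuous_subspaceT => z; exact: cb.
  by apply: (continuous_subspaceW _ cv); exact: subIsetl.
have [xs /set_mem [cxs /= xsb] Hxs] := EVT_max_rV (ex_intro _ x0 x0Q) cQ cvb.
have bx0 : beta x0 < m.
  rewrite /beta mulNr -mulrBr -[ltRHS]mulr1 ltr_pM2l// ltrBlDr ltrD2l /gauss /eb.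
  by rewrite ltr_expR ltr_nM2l// oppr_lt0.
have vxs : beta xs < c * h xs - u xs.
  by have := Hxs x0 (mem_set x0Q); rewrite -/m; lra.
have g1 x : gauss l y x <= 1.
  by rewrite /gauss -expR0 ler_expR mulNr oppr_le0 mulr_ge0 ?sqnorm_ge0// ltW.
have bpos x : 0 < beta x.
  rewrite /beta mulNr -mulrBr mulr_gt0// subr_gt0; have := g1 x; lra.
have [Dxs hxs] := inD _ cxs (lt_trans (bpos xs) vxs).
have xsb' : sqnorm (xs - y) < b.
  rewrite lt_neqAle xsb andbT; apply/eqP => E.
  have := Hx0 _ cxs; move: vxs; rewrite /beta /gauss E -/eb; lra.
have xsr := extr _ Dxs.
have near_b : \forall x \near xs, sqnorm (x - y) < b by exact: near_sqnorm_lt.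
have Dn : \forall x \near xs, D x by exact: open_nbhs_nbhs.
have chD := within_closure_interior oD ch.
have : m * laplacian_gauss l y xs <= k xs.
  apply: (su xs (fun x => c * h x + -1 * beta x) (fun x => m * laplacian_gauss l y x) Dxs).
  - apply: filterS Dn => x Dx.
    have -> : m * laplacian_gauss l y x = c * 0 + -1 * (0 + - m * laplacian_gauss l y x) by
      ring.
    apply: laplacian_atD; first by apply: laplacian_atZ; exact: lap0.
    apply: laplacian_atZ; apply: laplacian_atD; first exact: laplacian_at_cst.
    by apply: laplacian_atZ; exact: laplacian_at_gauss.
  - apply: filterS Dn => x Dx; apply: cont_atD; apply: cont_atZ; [exact: chD|exact: cb].
  - by apply: cont_atZ; exact: laplacian_gauss_cont.
  - near=> x; have xQ : Q x.
      split; first by apply: subset_closure; near: x.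
      by apply: ltW; near: x.
    have := Hxs x (mem_set xQ); lra.
apply/negP; rewrite -ltNge (le_lt_trans (kK _ Dxs))//.
apply: (@le_lt_trans _ _ (K * (c * lam))).
  rewrite ler_wpM2l//; apply: (@le_trans _ _ (c * h xs)).
    by have := bpos xs; move: vxs; lra.
  by rewrite ler_pM2l// ltW.
apply: (@lt_le_trans _ _ (m * (l * eb))).
  have -> : K * (c * lam) = M / (rho ^+ 2 * expR (n1 * L ^+ 2)).
    rewrite /M mulfK// mulf_neq0 ?expf_neq0 ?gt_eqF ?expR_gt0//.
    exact: lt_le_trans rrho.
  have rho0 : 0 < rho by exact: lt_le_trans rrho.
  rewrite ltr_pdivrMr ?mulr_gt0 ?exprn_gt0 ?expR_gt0//.
  apply: (lt_le_trans Mm); rewrite -[leLHS]mulr1 -[leRHS]mulrA ler_pM2l//.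
  rewrite /eb mulNr lb expRN.
  have EE : expR (n1 * L ^+ 2) != 0 by rewrite gt_eqF// expR_gt0.
  rewrite [_ * expR _]mulrC mulrA divfK//.
  rewrite /l mulrAC ler_pdivlMr ?exprn_gt0// mul1r.
  apply: (@le_trans _ _ (rho ^+ 2)); first by rewrite lerXn2r// nnegrE ltW.
  by rewrite ler_peMl ?sqr_ge0// /n1 lerDr.
rewrite ler_pM2l// /laplacian_gauss; apply: ler_pM; [exact: ltW|exact: ltW| |].
  have H : l * n1 <= l * (l * sqnorm (xs - y)).
    by rewrite ler_pM2l// /l mulrAC ler_pdivlMr ?exprn_gt0// ler_pM2l.
  have H2 : l <= 2 * l * (n1 + 1) by rewrite -mulrA mulrCA ler_peMr// ?ltW//; rewrite /n1;
    have : 0 <= N%:R :> R by []; lra.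
  have -> : 4 * l ^+ 2 * sqnorm (xs - y) - 2 * N%:R * l = 4 *
    (l * (l * sqnorm (xs - y)) - l * n1) + 2 * l * (n1 + 1).
    by rewrite /n1; ring.
  by rewrite -[leLHS]add0r lerD// mulr_ge0// subr_ge0.
by rewrite /eb /gauss ler_expR ler_nM2l ?oppr_lt0.
Unshelve. all: by end_near. Qed.

End comparison.

(** * Growth of harmonic functions along the columns of a Lipschitz domain *)

Section geometry.
Context {R : realType} {N : nat}.
Implicit Types (D : set 'rV[R]_N) (x y z w e : 'rV[R]_N) (t h : 'rV[R]_N -> R).

(** What the proof retains of the graph coordinates near the boundary point [z]: [t x]
    is the height of [x] above the graph and [e] the vertical unit vector. The Lipschitz
    constant of [t] is [1 / kap] for the Euclidean norm; the condition is stated with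
    squares to avoid roots. *)
Record chart D z t e (kap d0 : R) : Prop := Chart {
  chart_shift : forall x s, t (x + s *: e) = t x + s;
  chart_kap0 : 0 < kap;
  chart_kap1 : kap <= 1;
  chart_lip : forall x w (tau : R), 0 <= tau -> sqnorm (x - w) <= (kap * tau) ^+ 2 ->
    `|t x - t w| <= tau;
  chart_unit : sqnorm e = 1;
  chart_d0 : 0 < d0;
  chart_graph : forall x, `|x - z| < d0 -> (D x <-> 0 < t x) }.

Lemma sqnorm_tr x : sqnorm x = (x *m x^T) 0 0.
Proof. by rewrite mxE /sqnorm; apply: eq_bigr => j _; rewrite mxE expr2. Qed.

Lemma sqnorm_orth (A : 'M[R]_N) x : A *m A^T = 1%:M -> sqnorm (x *m A) = sqnorm x.
Proof. by move=> AA; rewrite !sqnorm_tr trmx_mul mulmxA -(mulmxA x) AA mulmx1. Qed.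

(** If [M] is a Lipschitz constant of the graph, then [1 + M] is one of the height: the
    coordinates are orthonormal, and the sup norm is at most the Euclidean one. *)
Lemma chart_exists D z : lipschitz_boundary D -> boundary D z ->
  exists t e kap d0, chart D z t e kap d0.
Proof.
move=> lD /lD[A [i [g [AA lg gD]]]].
have [M [M0 HM]] : exists M : R, 0 <= M /\ forall a b, `|g a - g b| <= M * `|a - b|.
  have [M [_ HM]] := lg; exists (`|M| + 1); split; first by rewrite addr_ge0.
  move=> a b; apply: (HM (`|M| + 1) _ (a, b)) => //.
  by rewrite (le_lt_trans (ler_norm M))// ltrDl.
have AtA : A^T *m A = 1%:M by exact: mulmx1C.
pose e := (delta_mx 0 i : 'rV[R]_N) *m A^T.
have eA : e *m A = delta_mx 0 i by rewrite /e -mulmxA AtA mulmx1.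
pose t x := (x *m A) 0 i - g (col' i (x *m A)).
have /nbhs_ballP[d0 /= d00 Hd0] := gD.
have M1 : 0 < 1 + M by rewrite ltr_wpDr.
exists t, e, (1 + M)^-1, d0; split => //.
- move=> x s; rewrite /t mulmxDl -scalemxAl eA coordDdelta eqxx mulr1.
  have -> : col' i (x *m A + s *: delta_mx 0 i) = col' i (x *m A).
    apply/rowP => j; rewrite !mxE eqxx/=.
    by rewrite eq_sym (negbTE (neq_lift i j)) mulr0 addr0.
  by rewrite addrAC.
- by rewrite invr_gt0.
- by rewrite invf_le1// lerDl.
- move=> x w tau tau0 xw.
  have nA : `|(x - w) *m A| <= (1 + M)^-1 * tau.
    apply: norm_le_sqnorm; last by rewrite sqnorm_orth.
    by rewrite mulr_ge0// invr_ge0 ltW.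
  rewrite /t (_ : _ - _ = ((x - w) *m A) 0 i - (g (col' i (x *m A)) - g (col' i (w *m A))));
    last first.
    by rewrite mulmxBl !mxE; ring.
  apply: (le_trans (ler_normB _ _)).
  have cN : `|col' i (x *m A) - col' i (w *m A)| <= `|(x - w) *m A|.
    apply: norm_rV_le => // j; have := coord_le_norm ((x - w) *m A) (lift i j).
    by rewrite mulmxBl !mxE.
  have H1 := coord_le_norm ((x - w) *m A) i.
  have H2 := HM (col' i (x *m A)) (col' i (w *m A)).
  have H3 : M * `|col' i (x *m A) - col' i (w *m A)| <= M * `|(x - w) *m A| by rewrite
    ler_wpM2l.
  have H4 : (1 + M) * `|(x - w) *m A| <= tau.
    by rewrite mulrC -ler_pdivlMr// mulrC.
  rewrite mulrDl mul1r in H4; lra.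
- rewrite /e sqnorm_orth; last by rewrite trmxK.
  rewrite /sqnorm (bigD1 i)//= mxE !eqxx expr1n big1 ?addr0// => j /negbTE ji.
  by rewrite mxE eqxx ji expr0n.
- move=> x xz; have := Hd0 x; rewrite -ball_normE/= distrC => /(_ xz) ->.
  by rewrite /t subr_gt0.
Qed.

Lemma sqnormD_le x y : sqnorm (x + y) <= 2 * sqnorm x + 2 * sqnorm y.
Proof.
rewrite /sqnorm !mulr_sumr -big_split/=; apply: ler_sum => j _; rewrite mxE -subr_ge0.
by rewrite (_ : _ - _ = (x 0 j - y 0 j) ^+ 2) ?sqr_ge0//; ring.
Qed.

Lemma sqnormZ (s : R) x : sqnorm (s *: x) = s ^+ 2 * sqnorm x.
Proof. by rewrite /sqnorm mulr_sumr; apply: eq_bigr => j _; rewrite mxE exprMn. Qed.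

(** The ball of radius [kap (t x) / 2] around a point [x] at height [t x] is in [D]. So
    [ball_growth], applied around the point of the same column at height
    [(1 + kap / 8) (t x)], carries a lower bound for [h] down to a ball around [x] and
    multiplies it by a [theta] that depends on [N] only. At heights above [T]
    compactness gives a first bound [m], and [j] steps reach the height [T rho^j]. *)
Lemma column_growth D z t e kap d0 h : open D -> chart D z t e kap d0 ->
  (forall x, D x -> {for x, continuous h}) -> (forall x, D x -> 0 < h x) ->
  visc_laplacian_le D h (fun=> 0) ->
  exists m T theta rho : R, [/\ [/\ 0 < m, 0 < T & 8 * T = d0],
    [/\ 0 < theta, theta < 1, 0 < rho & rho < 1] &
    forall j x, `|x - z| <= T -> T * rho ^+ j <= t x -> m * theta ^+ j <= h x].
Proof.
move=> oD [tS k0 k1 tL e1 d00 tD] ch h0 sh.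
pose T := d0 / 8.
have T0 : 0 < T by rewrite divr_gt0.
have T8 : d0 = 8 * T by rewrite /T mulrC divfK.
have ct : continuous t.
  move=> x; apply/(@cvgrPdist_le _ _ _ (nbhs x) (nbhs_filter x)) => w w0.
  have kw : 0 < (kap * w) ^+ 2 by rewrite exprn_gt0// mulr_gt0.
  have : \forall y \near x, sqnorm (y - x) < (kap * w) ^+ 2.
    by apply: near_sqnorm_lt; rewrite subrr sqnorm0.
  apply: filterS => y /ltW yx; apply: tL; first exact: ltW.
  by rewrite -sqnormN opprB.
pose base := [set w | `|w - z| <= 4 * T] `&` [set w | T / 2 <= t w].
have bD w : base w -> D w.
  move=> [/= wz tw]; apply/tD; first by rewrite (le_lt_trans wz)// T8 ltr_pM2r// ltr_nat.
  by apply: lt_le_trans tw; rewrite divr_gt0.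
have cb : compact base.
  apply: compact_closedI; first exact: compact_norm_ball.
  have -> : [set w | T / 2 <= t w] = t @^-1` [set s | T / 2 <= s] by [].
  by apply: closed_comp; [move=> x _; exact: ct|exact: closed_ge].
have [m [m0 Hm]] : exists m : R, 0 < m /\ forall w, base w -> m <= h w.
  have [b0|/nonemptyPn b0] := pselect (base !=set0); last first.
    by exists 1; split => // w; rewrite b0.
  have chb : {within base, continuous h}.
    by apply: continuous_in_subspaceT => x /set_mem /bD /ch.
  have [w0 /set_mem bw0 Hw0] := EVT_min_rV b0 cb chb.
  by exists (h w0); split; [apply/h0/bD|move=> w bw; apply: Hw0; rewrite inE].
pose n1 : R := N%:R + 1.
have n10 : 0 < n1 by rewrite /n1 ltr_wpDl.
(* The barrier of [ball_growth] at distance [2 q] from the centre, for the ball of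
   radius [4 q] and [lam = (N + 1) / q^2]. *)
pose theta := expR (- (4 * n1)) - expR (- (16 * n1)).
have th0 : 0 < theta by rewrite subr_gt0 ltr_expR ltrN2 ltr_pM2r// ltr_nat.
have th1 : theta < 1.
  have : expR (- (4 * n1)) <= 1 by rewrite -expR0 ler_expR oppr_le0 mulr_ge0// ltW.
  by have := expR_gt0 (- (16 * n1)); rewrite /theta; lra.
pose rho := (1 + kap / 8)^-1.
have kap8 : 0 < 1 + kap / 8 by rewrite addr_gt0// divr_gt0.
have rho0 : 0 < rho by rewrite invr_gt0.
have rho1 : rho < 1 by rewrite invf_lt1// ltrDl divr_gt0.
have e_norm s : 0 <= s -> `|s *: e| <= s.
  by move=> s0; apply: norm_le_sqnorm => //; rewrite sqnormZ e1 mulr1.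
(* The point [x + s *: e] is at distance at most [s] from [x] and higher by [s], so
   going up preserves the first inequality; with [t x <= 2 T] it keeps the columns
   inside the chart. *)
have claim j : forall x, `|x - z| <= T + t x -> T * rho ^+ j <= t x -> t x <= 2 * T ->
    forall w, sqnorm (w - x) <= (kap * (t x / 8)) ^+ 2 -> m * theta ^+ j <= h w.
  have baseP x : `|x - z| <= T + t x -> T <= t x -> t x <= 2 * T ->
    forall w, sqnorm (w - x) <= (kap * (t x / 8)) ^+ 2 -> m <= h w.
    move=> xz tx1 tx2 w wx; apply: Hm; split => /=.
      have H1 : `|w - x| <= t x / 8.
        apply: norm_le_sqnorm; first by rewrite divr_ge0// (le_trans (ltW T0)).
        apply: (le_trans wx); rewrite lerXn2r ?nnegrE ?mulr_ge0 ?divr_ge0// ?(ltW k0)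
          ?(le_trans (ltW T0))//.
        by rewrite ler_piMl// divr_ge0// (le_trans (ltW T0)).
      have := ler_normD (w - x) (x - z); rewrite subrKA; lra.
    have := tL w x (t x / 8) ltac:(rewrite divr_ge0// (le_trans (ltW T0))//) wx.
    rewrite ler_norml; lra.
  elim: j => [|j IH] x xz txj tx2 w wx.
    by rewrite expr0 mulr1; apply: (baseP x) => //; rewrite expr0 mulr1 in txj.
  have [Tt|tT] := leP T (t x).
    apply: (@le_trans _ _ m); last exact: (baseP x).
    by rewrite ler_piMr ?exprn_ile1// ltW.
  have tx0 : 0 < t x by apply: lt_le_trans txj; rewrite mulr_gt0// exprn_gt0.
  pose s := t x * (kap / 8).
  have s0 : 0 <= s by rewrite mulr_ge0 ?divr_ge0// ltW.
  pose x' := x + s *: e.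
  have tx' : t x' = t x * (1 + kap / 8) by rewrite /x' tS /s mulrDr mulr1.
  have tx'0 : 0 < t x' by rewrite tx' mulr_gt0.
  have txx' : t x <= t x' by rewrite tx' ler_peMr// ?lerDl ?divr_ge0// ltW.
  have tx'2 : t x' <= 2 * T.
    rewrite tx' mulrC; apply: ler_pM; rewrite ?(ltW tx0) ?(ltW tT) ?(ltW kap8)//.
    by move: k1; lra.
  have tx'j : T * rho ^+ j <= t x'.
    rewrite tx' -ler_pdivrMr// -mulrA; apply: le_trans txj.
    by rewrite exprSr.
  have x'z : `|x' - z| <= T + t x'.
    rewrite /x' tS addrAC; apply: (le_trans (ler_normD _ _)).
    by rewrite addrA; apply: lerD => //; exact: e_norm.
  have {}IH := IH x' x'z tx'j tx'2.
  pose q := kap * (t x' / 8).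
  have q0 : 0 < q by rewrite mulr_gt0// divr_gt0.
  have b16 v : sqnorm (v - x') <= 16 * q ^+ 2 -> D v.
    move=> vx.
    have vx2 : sqnorm (v - x') <= (kap * (t x' / 2)) ^+ 2.
      by apply: (le_trans vx); rewrite le_eqVlt; apply/orP; left; apply/eqP; rewrite /q;
        field.
    have nvx : `|v - x'| <= t x' / 2.
      apply: norm_le_sqnorm; first by rewrite divr_ge0// ltW.
      apply: (le_trans vx2); rewrite lerXn2r ?nnegrE ?mulr_ge0 ?divr_ge0// ?(ltW k0)
        ?(ltW tx'0)//.
      by rewrite ler_piMl// divr_ge0// ltW.
    apply/tD.
      have := ler_normD (v - x') (x' - z); rewrite subrKA T8; lra.
    have := tL v x' (t x' / 2) ltac:(rewrite divr_ge0// ltW//) vx2.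
    rewrite ler_norml; lra.
  have mth : 0 < m * theta ^+ j by rewrite mulr_gt0// exprn_gt0.
  have lq : n1 / q ^+ 2 * q ^+ 2 = n1 by rewrite divfK// expf_neq0// gt_eqF.
  have lam0 : 0 < n1 / q ^+ 2 by rewrite divr_gt0// exprn_gt0.
  have Kl : 0 < n1 / q ^+ 2 * (4 * (n1 / q ^+ 2) * q ^+ 2 - 2 * N%:R).
    rewrite mulr_gt0// -mulrA lq /n1; have : 0 <= N%:R :> R by []; lra.
  have wx' : sqnorm (w - x') <= 4 * q ^+ 2.
    rewrite (_ : w - x' = (w - x) + (- s) *: e); last by rewrite /x' opprD addrA scaleNr.
    apply: (le_trans (sqnormD_le _ _)); rewrite sqnormZ e1 mulr1 sqrrN.
    have A1 : kap * (t x / 8) <= q by rewrite /q ler_pM2l// ler_pM2r// invr_gt0.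
    have A2 : (kap * (t x / 8)) ^+ 2 <= q ^+ 2.
      by rewrite lerXn2r ?nnegrE// ?(ltW q0)// mulr_ge0 ?divr_ge0// ltW.
    have A3 : s = kap * (t x / 8) by rewrite /s; ring.
    rewrite A3; move: wx A2; lra.
  have := ball_growth sh (lexx 0) mth lam0 ch (fun x Dx => ltW (h0 x Dx))
    (fun x _ => ltac:(by rewrite mul0r)) Kl b16 IH.
  move=> /(_ w); have -> : sqnorm (w - x') <= 16 * q ^+ 2.
    by apply: (le_trans wx'); rewrite ler_pM2r ?exprn_gt0// ler_nat.
  move=> /(_ isT); apply: le_trans.
  rewrite exprSr mulrA ler_pM2l// /theta /gauss lerB//.
    rewrite ler_expR mulNr lerN2 -[X in _ <= 4 * X]lq mulrCA ler_pM2l//.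
  by rewrite ler_expR mulNr lerN2 -[X in 16 * X <= _]lq mulrCA.
exists m, T, theta, rho; split => // j x xz txj.
have tx0 : 0 < t x by apply: lt_le_trans txj; rewrite mulr_gt0// exprn_gt0.
have [tx2|tx2] := leP (t x) (2 * T).
  apply: (claim j x) => //; first by rewrite (le_trans xz)// lerDl ltW.
  by rewrite subrr sqnorm0 sqr_ge0.
apply: (@le_trans _ _ m); first by rewrite ler_piMr ?exprn_ile1// ltW.
by apply: Hm; split => /=; move: xz tx2 T0; lra.
Qed.

End geometry.

(** * Sublevel sets as thin layers along the boundary *)

Lemma within_near {R : realType} {T : topologicalType} (A : set T) (f : T -> R) x (e : R) :
  {within A, continuous f} -> A x -> 0 < e -> \forall y \near x, A y -> `|f x - f y| <= e.
Proof.
move=> cf Ax e0.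
have /(@cvgrPdist_le _ _ _ (nbhs (x : subspace A)) (nbhs_filter _))/(_ e e0) := cf x.
by move=> H; have : within A (nbhs x) [set y | `|f x - f y| <= e] by rewrite nbhs_subspace_in.
Qed.

Section boundary_layers.
Context {R : realType} {N : nat}.
Implicit Types (D : set 'rV[R]_N) (x y z w e : 'rV[R]_N) (t h : 'rV[R]_N -> R).

(** All the constants are read off one integer [n], large enough near each point of the
    closure and then everywhere by compactness. Near a point of [D] the assumption on
    [h x] fails for large [n]. Near a boundary point [column_growth] bounds the height
    [t x] by [T rho^k]. The point [x - 2 (t x) e] has height [- t x], so the ball around
    it of radius [kap (t x)] lies below the graph. *)
Lemma boundary_layer D h : open D -> bounded_set D -> lipschitz_boundary D ->
  (forall x, D x -> {for x, continuous h}) -> (forall x, D x -> 0 < h x) ->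
  visc_laplacian_le D h (fun=> 0) ->
  exists n : nat, (1 <= n)%N /\ forall x, D x -> forall k, h x < n.+1%:R^-1 ^+ k.+1 ->
    exists y (r : R), [/\ 0 < r, r <= n.+1%:R * (1 - n.+2%:R^-1) ^+ k,
      (forall w, D w -> r ^+ 2 <= sqnorm (w - y)) & sqnorm (x - y) < (n.+1%:R * r) ^+ 2].
Proof.
move=> oD bD lD ch h0 sh.
pose P (n : nat) x := D x -> forall k, h x < n.+1%:R^-1 ^+ k.+1 ->
    exists y (r : R), [/\ 0 < r, r <= n.+1%:R * (1 - n.+2%:R^-1) ^+ k,
      (forall w, D w -> r ^+ 2 <= sqnorm (w - y)) & sqnorm (x - y) < (n.+1%:R * r) ^+ 2].
have near_n (B : R) : \forall n \near \oo, B <= n.+1%:R.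
  by near=> n; rewrite (@le_trans _ _ n%:R) ?ler_nat//; near: n; exact: nbhs_infty_ger.
have /compact_near_coveringP cc := compact_closure_bounded bD.
have : \forall n \near \oo, closure D `<=` P n.
  apply: cc => z cz.
  have [Dz|bz] := closure_boundary oD cz.
    have hz : 0 < h z / 2 by rewrite divr_gt0// h0.
    exists ([set x | h z / 2 < h x], [set n | (h z / 2)^-1 <= n.+1%:R]) => /=.
      split; last exact: near_n.
      by apply: (@cvgr_gt _ _ _ _ h (h z) (ch z Dz)); rewrite ltr_pdivrMr// mulr_natr mulr2n
        ltrDl h0.
    move=> [x n] /= [hx hn] Dx k hk; exfalso.
    have n0 : 0 < n.+1%:R^-1 :> R by rewrite invr_gt0.
    have nh : n.+1%:R^-1 <= h z / 2 by rewrite invf_ple ?posrE.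
    have : n.+1%:R^-1 ^+ k.+1 <= n.+1%:R^-1 :> R.
      have n1 : n.+1%:R^-1 <= 1 :> R by rewrite invf_le1 ?ltr0n// ler1n.
      by rewrite exprS; apply: ler_piMr; [exact: ltW|apply: exprn_ile1 => //; exact: ltW].
    by move=> H; have := lt_trans hx (lt_le_trans hk (le_trans H nh)); rewrite ltxx.
  have [t [e [kap [d0 ct]]]] := chart_exists lD bz.
  have [m [T [theta [rho [[m0 T0 T8] [th0 th1 rho0 rho1] Hcol]]]]] :=
    column_growth oD ct ch h0 sh.
  have [tS k0 k1 tL e1 d00 tD] := ct.
  exists ([set x | `|x - z| < T],
    [set n : nat | [/\ m^-1 <= n.+1%:R :> R, theta^-1 <= n.+1%:R :> R,
     (1 - rho)^-1 <= n.+1%:R :> R, T <= n.+1%:R & 3 / kap <= n.+1%:R]]) => /=.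
    split; last by near=> n; split; near: n; exact: near_n.
    by have := nbhsx_ballx z T T0; apply: filterS => x; rewrite -ball_normE/= distrC.
  move=> [x n] /= [xz [nm nth nrho nT nk]] Dx k hk.
  set q : R := n.+1%:R in nm nth nrho nT nk hk *.
  have q0 : 0 < q by rewrite /q.
  have tx0 : 0 < t x by apply/tD => //; apply: (lt_trans xz); rewrite -T8; lra.
  have qm : q^-1 <= m by rewrite invf_ple ?posrE.
  have qth : q^-1 <= theta by rewrite invf_ple ?posrE.
  have txT : t x < T * rho ^+ k.
    rewrite ltNge; apply/negP => /(Hcol k x (ltW xz)); apply/negP; rewrite -ltNge.
    apply: (lt_le_trans hk); rewrite exprS; apply: ler_pM; rewrite ?invr_ge0 ?exprn_ge0
      ?invr_ge0 ?(ltW q0)//.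
    by rewrite lerXn2r ?nnegrE// ?invr_ge0 ltW.
  have txT' : t x < T.
    by apply: (lt_le_trans txT); rewrite ler_piMr ?exprn_ile1// ltW.
  pose tx2 := 2 * t x.
  exists (x + (- tx2) *: e), (kap * t x); split.
  - by rewrite mulr_gt0.
  - apply: (@le_trans _ _ (t x)); first by rewrite ler_piMl// ltW.
    apply: (le_trans (ltW txT)); apply: ler_pM => //; rewrite ?exprn_ge0 ?(ltW T0)
      ?(ltW rho0)//.
    have q2 : n.+2%:R^-1 <= 1 - rho.
      rewrite invf_ple ?posrE ?subr_gt0//; apply: (le_trans nrho).
      by rewrite /q ler_nat.
    have q3 : rho <= 1 - n.+2%:R^-1 by rewrite lerBrDl -lerBrDr.
    by rewrite lerXn2r ?nnegrE// ?(ltW rho0)// (le_trans (ltW rho0)).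
  - move=> w Dw; rewrite leNgt; apply/negP => wy.
    have L := tL _ _ _ (ltW tx0) (ltW wy).
    have ty : t (x + (- tx2) *: e) = - t x by rewrite tS /tx2; ring.
    have tw : t w <= 0 by move: L; rewrite ty ler_norml; lra.
    have nw : `|w - (x + (- tx2) *: e)| <= t x.
      apply: norm_le_sqnorm; first exact: ltW.
      apply: (le_trans (ltW wy)); rewrite lerXn2r ?nnegrE ?mulr_ge0 ?(ltW k0) ?(ltW tx0)//.
      by rewrite ler_piMl// ltW.
    have ne : `|(- tx2) *: e| <= tx2.
      apply: norm_le_sqnorm; first by rewrite mulr_ge0// ltW.
      by rewrite sqnormZ e1 mulr1 sqrrN.
    have wz : `|w - z| < d0.
      have N1 := ler_normD (w - (x + (- tx2) *: e)) (x + (- tx2) *: e - z).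
      rewrite subrKA [x + _ - z]addrAC in N1.
      have N2 := ler_normD (x - z) ((- tx2) *: e).
      move: N1 N2 nw ne xz T8 txT'; rewrite /tx2; lra.
    by have /(tD w wz) := Dw; rewrite ltNge tw.
  - rewrite opprD addrA subrr add0r sqnormN sqnormZ e1 mulr1 sqrrN.
    (* The distance from [x] to the centre of the ball is [2 (t x)]. *)
    have kq : 3 <= q * kap by rewrite -ler_pdivrMr.
    have H : tx2 < q * (kap * t x).
      by rewrite mulrA /tx2 ltr_pM2r// (lt_le_trans _ kq)// ltr_nat.
    by rewrite ltrXn2r ?nnegrE// ?mulr_ge0// ltW.
move=> H.
near \oo => n; exists n; split; first by near: n; exact: nbhs_infty_ge.
move=> x Dx; have : closure D `<=` P n by near: n.
by move=> /(_ x (subset_closure Dx)); apply.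
Unshelve. all: by end_near. Qed.

End boundary_layers.

(** * The nonlinearity on bounded ranges *)

Section nonlinearity.
Context {R : realType}.
Variable phi : R -> R.
Hypotheses (phi_ge0 : forall t, 0 <= t -> 0 <= phi t)
  (phi_cont : {within `[0, +oo[, continuous phi})
  (phi_nd : forall s t, 0 <= s -> s <= t -> phi s <= phi t)
  (phi0 : phi 0 = 0)
  (phi_limsup : (limf_esup (fun t : R => (phi t / t)%:E) 0^'+ < +oo)%E).

(** By the limsup near 0, and away from 0 because [phi] is bounded by its value at the
    right end of the range. *)
Lemma linear_bound (U : R) : exists K : R, 0 < K /\ forall t, 0 <= t -> t <= U -> phi t <=
  K * t.
Proof.
have [C [d [C0 d0 Hd]]] : exists C d : R,
  [/\ 0 < C, 0 < d & forall t, 0 < t < d -> phi t <= C * t].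
  move: phi_limsup; rewrite limf_esupE => /ereal_inf_lt[_ [V V0 <-] Voo].
  have [d /= d0 Hd] := V0.
  have [C [C0 HC]] : exists C : R, 0 < C /\ forall t, V t -> phi t / t <= C.
    move: Voo; set s := ereal_sup _ => soo.
    have Hs t : V t -> ((phi t / t)%:E <= s)%E by move=> Vt; apply: ereal_sup_ubound;
      exists t.
    case: s soo Hs => [s| |] //= _ Hs.
      exists (`|s| + 1); split; first by rewrite ltr_wpDl.
      by move=> t /Hs; rewrite lee_fin => /le_trans; apply; rewrite (le_trans (ler_norm s))//
        lerDl.
    by exists 1; split=> // t /Hs; rewrite leeNy_eq.
  exists C, d; split=> // t /andP[t0 td].
  rewrite -ler_pdivrMr//; apply: HC; apply: Hd => //=.
  by rewrite /ball_/= sub0r normrN gtr0_norm.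
pose d2 := d / 2.
have d20 : 0 < d2 by rewrite divr_gt0.
pose U' := Num.max 0 U.
have U'0 : 0 <= U' by rewrite le_max lexx.
have pU := phi_ge0 U'0.
exists (C + phi U' / d2); split; first by rewrite ltr_wpDr// divr_ge0// ltW.
move=> t; rewrite le_eqVlt => /predU1P[<-|t0] tU; first by rewrite phi0 mulr0.
have [td|dt] := ltP t d.
  apply: (le_trans (Hd t _)); first by rewrite t0 td.
  by rewrite ler_pM2r// lerDl divr_ge0// ltW.
apply: (@le_trans _ _ (phi U')).
  by apply: phi_nd; [exact: ltW|rewrite le_max tU orbT].
rewrite mulrDl -[leLHS]add0r; apply: lerD; first by apply: mulr_ge0; exact: ltW.
rewrite mulrAC ler_pdivlMr// ler_wpM2l// /d2; move: d0 dt; lra.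
Qed.

Lemma continuous_comp_phi {T : topologicalType} (u : T -> R) x : {for x, continuous u} ->
  (\forall y \near x, 0 <= u y) -> {for x, continuous (fun y => 2 * phi (u y))}.
Proof.
move=> cu u0; apply: cont_atZ.
have ux0 : 0 <= u x by exact: nbhs_singleton u0.
apply/(@cvgrPdist_le _ _ _ (nbhs x) (nbhs_filter x)) => e e0.
have H : \forall s \near u x, `[0, +oo[%classic s -> `|phi (u x) - phi s| <= e.
  by apply: within_near => //=; rewrite in_itv/= ux0.
have H' : \forall y \near x,
    `[0, +oo[%classic (u y) -> `|phi (u x) - phi (u y)| <= e by exact: (cu _ H).
by apply: filterS2 u0 H' => y uy0; apply; rewrite /= in_itv/= uy0.
Qed.

End nonlinearity.

(** * Lower bound by induction over the level sets *)

Section iteration.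
Context {R : realType} {N : nat}.
Implicit Types (D : set 'rV[R]_N) (x : 'rV[R]_N) (u h k : 'rV[R]_N -> R).

Lemma exists_pow_lt (B rho : R) : 0 <= rho -> rho < 1 -> 0 < B -> exists k : nat, rho ^+ k <
  B.
Proof.
move=> r0 r1 B0.
have : `|rho| < 1 by rewrite ger0_norm.
move=> /cvg_expr/cvgr0Pnorm_lt/(_ B B0) [k _ Hk].
exists k; have := Hk k (leqnn k).
by rewrite /= ger0_norm// exprn_ge0.
Qed.

(** The minimum is taken of [u + 2 (lam - h)^+]: it equals [u] where [lam <= h] and is
    positive on the whole closure of [D], including the boundary points where [u]
    vanishes. *)
Lemma lower_on_level D u h (lam : R) : open D -> bounded_set D ->
  {within closure D, continuous u} -> {within closure D, continuous h} ->
  (forall x, D x -> 0 < u x) -> (forall x, boundary D x -> u x = h x) ->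
  (forall x, closure D x -> 0 <= u x) -> 0 < lam ->
  exists c : R, [/\ 0 < c, c <= 1 & forall x, D x -> lam <= h x -> c * h x <= u x].
Proof.
move=> oD bD cu ch u0 uh u0' lam0.
have cD := compact_closure_bounded bD.
have [D0|/nonemptyPn D0] := pselect (closure D !=set0); last first.
  exists 1; split => // x Dx; have : closure D x by exact: subset_closure.
  by rewrite D0.
have cw : {within closure D, continuous (fun x => u x + (`|lam - h x| + (lam - h x)))}.
  have cl : {within closure D, continuous (fun x => lam - h x)}.
    by apply: within_contB => //; apply: continuous_subspaceT; exact: cst_continuous.
  apply: within_contD => //; apply: within_contD => //.
  move=> x; apply: (@continuous_comp (subspace (closure D)) _ _ (fun x => lam - h x)
    Num.norm); first exact: cl.
  exact: norm_continuous.
have [x1 /set_mem cx1 Hx1] := EVT_min_rV D0 cD cw.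
have [x2 /set_mem cx2 Hx2] := EVT_max_rV D0 cD ch.
set mu := (u x1 + _) in Hx1.
have mu0 : 0 < mu.
  rewrite /mu; have [hl|hl] := ltP (h x1) lam.
    rewrite gtr0_norm ?subr_gt0//; have := u0' _ cx1; move: hl; lra.
  rewrite ler0_norm ?subr_le0// addNr addr0.
  have [/u0//|/uh ->] := closure_boundary oD cx1.
  exact: lt_le_trans hl.
pose H := Num.max 1 (h x2).
have H1 : 1 <= H by rewrite le_max lexx.
have H0 : 0 < H by exact: lt_le_trans H1.
exists (Num.min 1 (mu / H)); split.
- by rewrite lt_min ltr01 divr_gt0.
- by rewrite ge_min lexx.
- move=> x Dx lx; have cx : closure D x by exact: subset_closure.
  have h0 : 0 <= h x by apply: le_trans lx; exact: ltW.
  apply: (@le_trans _ _ (mu / H * h x)); first by rewrite ler_wpM2r// ge_min lexx orbT.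
  apply: (@le_trans _ _ mu).
    rewrite mulrAC ler_pdivrMr// ler_wpM2l ?(ltW mu0)//.
    by rewrite (le_trans (Hx2 x (mem_set cx)))// le_max lexx orbT.
  have := Hx1 x (mem_set cx); rewrite ler0_norm ?subr_le0//; lra.
Qed.

(** Passing from the level [lam i] to the next one costs the factor [1 - B rho^(2 i)] by
    [thin_layer]. The constants [c i = c0 / 2 (1 + rho^i)] decrease by at least as much
    from [k0] on, and they stay above [c0 / 2]. *)
Lemma lower_comparison D u h k (K : R) : open D -> connected D -> bounded_set D ->
  lipschitz_boundary D ->
  {within closure D, continuous u} -> {within closure D, continuous h} ->
  visc_laplacian_le D u k -> 0 < K -> (forall x, D x -> k x <= K * u x) ->
  (forall x, D x -> laplacian_at h x 0) ->
  (forall x, closure D x -> 0 <= h x) ->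
  (forall x, D x -> 0 < u x) -> (forall x, D x -> 0 < h x) ->
  (forall x, boundary D x -> u x = h x) ->
  exists c : R, [/\ 0 < c, c <= 1 & forall x, D x -> c * h x <= u x].
Proof.
move=> oD conD bD lD cu ch su K0 kK lh h0' u0 h0 uh.
have chD := within_closure_interior oD ch.
have [n [n1 Hn]] := boundary_layer oD bD lD chD h0 (visc_of_harmonic lh).
set q : R := n.+1%:R in Hn.
have q0 : 0 < q by rewrite /q.
have q1 : 1 < q by rewrite /q ltr1n.
set rho : R := 1 - n.+2%:R^-1 in Hn.
have n2 : 0 < n.+2%:R^-1 :> R by rewrite invr_gt0.
have rho1 : rho < 1 by rewrite /rho ltrBlDr ltrDl.
have rho0 : 0 <= rho by rewrite /rho subr_ge0 invf_le1// ler1n.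
pose E := expR ((N%:R + 1) * q ^+ 2).
have E0 : 0 < E by exact: expR_gt0.
pose B := K * q ^+ 3 * E.
have B0 : 0 < B by rewrite /B !mulr_gt0// exprn_gt0.
have rho1' : 0 < 1 - rho by rewrite subr_gt0.
(* For [i >= k0] the relative loss [B rho^(2 i)] is at most [rho^i (1 - rho) / 2], and
   [c0] times this is [c i - c i.+1]. *)
have [k0 Hk0] := @exists_pow_lt ((1 - rho) / (2 * B)) rho rho0 rho1
  ltac:(by rewrite divr_gt0// mulr_gt0).
pose lam j : R := q^-1 ^+ j.+1.
have lam0 j : 0 < lam j by rewrite exprn_gt0// invr_gt0.
have u0' x : closure D x -> 0 <= u x.
  by move=> cx; have [/u0/ltW//|bx] := closure_boundary oD cx; rewrite uh// h0'.
have [c0 [c00 c01 Hc0]] := lower_on_level oD bD cu ch u0 uh u0' (lam0 k0).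
pose c j : R := c0 / 2 * (1 + rho ^+ j).
have rj1 j : rho ^+ j <= 1 by rewrite exprn_ile1// ltW.
have rj0 j : 0 <= rho ^+ j by rewrite exprn_ge0.
have c02 : 0 < c0 / 2 by rewrite divr_gt0.
have cj0 j : 0 < c j by rewrite /c mulr_gt0// ltr_wpDr.
have cj1 j : c j <= c0.
  by rewrite /c -[leRHS](divfK (_ : 2 != 0 :> R))// ler_pM2l//; have := rj1 j; lra.
have claim j : forall x, D x -> lam (k0 + j)%N <= h x -> c (k0 + j)%N * h x <= u x.
  elim: j => [|j IH] x Dx.
    rewrite addn0 => lx; apply: le_trans (Hc0 x Dx lx).
    by apply: ler_wpM2r => //; exact/ltW/h0.
  rewrite addnS; set i := (k0 + j)%N in IH *; move=> lx.
  have bnd y : boundary D y -> c i * h y <= u y.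
    move=> bdy; rewrite uh// ler_piMl ?h0'//; first by case: bdy.
    exact: le_trans (cj1 i) c01.
  have ext y : D y -> h y < lam i -> exists z (r : R), [/\ 0 < r, r <= q * rho ^+ i,
      (forall w, D w -> r ^+ 2 <= sqnorm (w - z)) & sqnorm (y - z) < (q * r) ^+ 2].
    by move=> Dy hy; exact: (Hn y Dy i hy).
  have := thin_layer oD bD cu ch su (ltW K0) kK lh (cj0 i) (ltW (lam0 i)) q0 bnd IH ext
    (subset_closure Dx).
  rewrite -/E => H.
  have hx : lam i <= q * h x.
    by rewrite -ler_pdivrMl//; move: lx; rewrite /lam exprS.
  have ri : (rho ^+ i) ^+ 2 * B <= rho ^+ i * ((1 - rho) / 2).
    rewrite expr2 -mulrA ler_wpM2l//.
    apply: (@le_trans _ _ (rho ^+ k0 * B)).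
      by rewrite ler_wpM2r ?(ltW B0)// /i exprD ler_piMr.
    have -> : (1 - rho) / 2 = (1 - rho) / (2 * B) * B by field; rewrite gt_eqF.
    by rewrite ler_pM2r// ltW.
  have H2 : K * (c i * lam i) * ((q * rho ^+ i) ^+ 2 * E) <=
    c i * h x * ((rho ^+ i) ^+ 2 * B).
    have -> : c i * h x * ((rho ^+ i) ^+ 2 * B) = K * (c i * (q * h x)) *
      ((q * rho ^+ i) ^+ 2 * E).
      by rewrite /B; ring.
    apply: ler_wpM2r; first by rewrite mulr_ge0 ?sqr_ge0// ltW.
    by rewrite ler_pM2l// ler_pM2l.
  have H3 : c i.+1 <= c i * (1 - (rho ^+ i) ^+ 2 * B).
    have P : c i * ((rho ^+ i) ^+ 2 * B) <= c0 * (rho ^+ i * ((1 - rho) / 2)).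
      by apply: ler_pM => //; rewrite ?(ltW (cj0 i))// mulr_ge0 ?sqr_ge0// ltW.
    rewrite mulrBr mulr1 lerBrDr; apply:
      (@le_trans _ _ (c i.+1 + c0 * (rho ^+ i * ((1 - rho) / 2)))).
      by rewrite lerD2l.
    by rewrite /c exprS le_eqVlt; apply/orP; left; apply/eqP; field.
  have H4 : c i.+1 * h x <= c i * (1 - (rho ^+ i) ^+ 2 * B) * h x.
    by rewrite ler_wpM2r// ltW// h0.
  apply: (le_trans H4).
  have -> : c i * (1 - (rho ^+ i) ^+ 2 * B) * h x = c i * h x - c i * h x *
    ((rho ^+ i) ^+ 2 * B) by ring.
  by move: H H2; lra.
exists (c0 / 2); split => //; first by move: c01 c00; lra.
move=> x Dx.
have q1' : q^-1 < 1 by rewrite invf_lt1.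
have [k1 Hk1] := @exists_pow_lt (h x) (q^-1) ltac:(by rewrite invr_ge0 ltW) q1' (h0 x Dx).
apply: (@le_trans _ _ (c (k0 + k1)%N * h x)).
  by rewrite ler_wpM2r ?(ltW (h0 x Dx))// /c ler_peMr ?(ltW c02)// lerDl.
apply: claim => //; apply: le_trans (ltW Hk1).
rewrite /lam -addSn addnC exprD ler_piMr ?exprn_ge0 ?invr_ge0 ?(ltW q0)//.
by rewrite exprn_ile1// ?invr_ge0 ?(ltW q0)// ltW.
Qed.

End iteration.

(** * Proportionality of the two solutions *)

Theorem theorem4p1 (R : realType) (N : nat) (hN : (3 <= N)%N)
    (D : set 'rV[R]_N) (hD : bounded_lipschitz_domain D)
    (phi : R -> R)
    (phi_ge0 : forall t, 0 <= t -> 0 <= phi t)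
    (phi_cont : {within `[0, +oo[, continuous phi})
    (phi_nd : forall s t, 0 <= s -> s <= t -> phi s <= phi t)
    (phi0 : phi 0 = 0)
    (phi_limsup : (limf_esup (fun t : R => (phi t / t)%:E) 0^'+ < +oo)%E)
    (f : 'rV[R]_N -> R)
    (f_cont : {within boundary D, continuous f})
    (f_ge0 : forall x, boundary D x -> 0 <= f x)
    (h u : 'rV[R]_N -> R) (hh : is_H D f h) (hu : is_Hphi D phi f u) :
  proportional D u h.
Proof.
have [oD conD D0 bD lD] := hD.
have [ch harm hf] := hh; have [cu u0 du uf] := hu.
have N0 : (0 < N)%N by exact: leq_trans hN.
have cD := compact_closure_bounded bD.
have cuD := within_closure_interior oD cu.
have chD := within_closure_interior oD ch.
have cdu x : D x -> closure D x by exact: subset_closure.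
have lh := harmonic_laplacian_at oD harm.
have cphi x : D x -> {for x, continuous (fun y => 2 * phi (u y))}.
  move=> Dx; apply: (continuous_comp_phi phi_cont (cuD x Dx)).
  have Dn : \forall y \near x, D y by exact: open_nbhs_nbhs.
  by apply: filterS Dn => y Dy; apply: u0; exact: cdu.
have su := visc_of_distr oD cuD cphi du.
have cNu x : D x -> {for x, continuous (fun y => - u y)}.
  by move=> Dx; exact/cont_atN/cuD.
have cNphi x : D x -> {for x, continuous (fun y => - (2 * phi (u y)))}.
  by move=> Dx; exact/cont_atN/cphi.
have sNu := visc_of_distr oD cNu cNphi (distr_laplacian_opp du).
have uh := upper_comparison N0 oD bD cu ch sNu
  (fun x Dx => mulr_ge0 (ler0n _ 2) (phi_ge0 _ (u0 x (cdu x Dx)))) lh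
  (fun x bx => ltac:(by rewrite uf// hf)).
have h0 x : closure D x -> 0 <= h x by move=> cx; exact: le_trans (u0 x cx) (uh x cx).
have [[z Dz hz]|hz] := pselect (exists2 z, D z & 0 < h z); last first.
  exists 1 => // x Dx.
  have hx : h x = 0.
    apply/le_anti/andP; split; last exact/h0/cdu.
    by rewrite leNgt; apply/negP => hx; apply: hz; exists x.
  have := uh x (cdu x Dx); have := u0 x (cdu x Dx); rewrite hx => H1 H2.
  by rewrite !mulr0 H1 H2.
have [xM /set_mem _ HM] := EVT_max_rV (ex_intro _ z (cdu z Dz)) cD cu.
have [C [C0 HC]] := linear_bound phi_ge0 phi_nd phi0 phi_limsup (u xM).
have kK x : D x -> 2 * phi (u x) <= 2 * C * u x.
  move=> Dx; rewrite -mulrA ler_pM2l//; apply: HC; first by apply: u0; exact: cdu.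
  by apply: HM; rewrite inE; exact: cdu.
have C20 : 0 < 2 * C by rewrite mulr_gt0.
have hpos := positivity oD conD (visc_of_harmonic lh) (lexx 0) chD
  (fun x Dx => h0 x (cdu x Dx))
  (fun x _ => ltac:(by rewrite mul0r)) (ex_intro2 _ _ z Dz hz).
(* If [u] vanished in [D], it would vanish on the boundary by continuity, and [h] in [D]
   by the maximum principle. *)
have [w Dw uw] : exists2 w, D w & 0 < u w.
  apply/not_exists2P => H.
  have u00 x : D x -> u x = 0.
    move=> Dx; apply/le_anti/andP; split; last exact/u0/cdu.
    by rewrite leNgt; apply/negP; have [|] := H x.
  have b0 x : boundary D x -> h x <= 0.
    move=> bx; have cx : closure D x by case: bx.
    rewrite hf// -uf// leNgt; apply/negP => ux.
    have /(cx _)[y [Dy /(_ (cdu y Dy))]] := within_near cu cx (divr_gt0 ux (ltr0n R 2)).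
    rewrite (u00 y Dy) subr0 gtr0_norm//; lra.
  have sNh : visc_laplacian_le D (fun x => - h x) (fun=> - 0).
    rewrite oppr0; apply: visc_of_harmonic => x Dx.
    have := laplacian_atZ (-1) (lh x Dx); rewrite mulr0.
    by under eq_fun do rewrite mulN1r.
  have c0 : {within closure D, continuous (fun=> 0 : R)}.
    by apply: continuous_subspaceT; exact: cst_continuous.
  have := upper_comparison (h := fun=> 0) N0 oD bD ch c0 sNh
    (fun _ _ => lexx 0) (fun x _ => laplacian_at_cst 0 x) b0 (cdu z Dz).
  by rewrite leNgt hz.
have upos := positivity oD conD su (ltW C20) cuD (fun x Dx => u0 x (cdu x Dx)) kK
  (ex_intro2 _ _ w Dw uw).
have [c [c0 c1 Hc]] := lower_comparison oD conD bD lD cu ch su C20 kK lh h0 upos hpos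
  (fun x bx => ltac:(by rewrite uf// hf)).
exists c^-1; first by rewrite invr_gt0.
move=> x Dx; rewrite invrK Hc//=; apply: (le_trans (uh x (cdu x Dx))).
by apply: ler_peMl; [exact/h0/cdu|rewrite invf_ge1].
Qed.
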